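(* Consider a family of $n\times n$ switches operating under the MaxWeight scheduling algorithm, parameterized by $0<\epsilon<1$, with arrival processes $a^{(\epsilon)}(t)$ bounded componentwise by $a_{\max}$ (not depending on $\epsilon$). Suppose all ports are saturated: the mean arrival rate vector is $\lambda^{(\epsilon)}=\nu-\epsilon k$, where $\nu\in\mathbb R^{n^2}$ satisfies $\sum_j\nu_{ij}=1$ for all $i$, $\sum_i\nu_{ij}=1$ for all $j$, and $\nu_{\min}=\min_{i,j}\nu_{ij}>0$, and $k\in\mathbb R_+^{n^2}$ satisfies $\langle k,\mathbf 1\rangle=n$ with $\kappa_i>0$ and $\tilde\kappa_j>0$ for all $i,j$. Suppose the variance vectors $(\sigma^{(\epsilon)})^2$ satisfy $\|\sigma^{(\epsilon)}\|^2\le\tilde\sigma^2$ for some $\tilde\sigma^2$ not depending on $\epsilon$. Let $\bar q^{(\epsilon)}$ be the steady-state queue length vector. Let $\alpha\in\mathbb R^{n^2}$ be any fixed weight vector with $\langle\alpha,e^{(i)}\rangle=n\kappa_i$ and $\langle\alpha,\tilde e^{(j)}\rangle=n\tilde\kappa_j$ for all $1\le i,j\le n$. Then for every $0<\epsilon\le\nu_{\min}/(2\|k\|)$, $$\Big(1-\frac1{2n}\Big)\frac{\|\sigma^{(\epsilon)}\|^2}{\epsilon}-B_3(\epsilon,n)\le\mathbb E\big[\langle\bar q^{(\epsilon)},\alpha\rangle\big]\le\Big(1-\frac1{2n}\Big)\frac{\|\sigma^{(\epsilon)}\|^2}{\epsilon}+B_4(\epsilon,n),$$ where $B_3,B_4$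 are functions that are $o(1/\epsilon)$ as $\epsilon\to0$. Consequently, if $(\sigma^{(\epsilon)})^2\to\sigma^2$ as $\epsilon\downarrow0$, then $$\lim_{\epsilon\to0}\epsilon\,\mathbb E\big[\langle\bar q^{(\epsilon)},\alpha\rangle\big]=\Big(1-\frac1{2n}\Big)\|\sigma\|^2 .$$
   Context: Notation. Elements of $\mathbb R^{n^2}$ are written as $n\times n$ matrices $x=(x_{ij})$, with $\langle x,y\rangle=\sum_{i,j}x_{ij}y_{ij}$ and $\|x\|=\sqrt{\langle x,x\rangle}$. $\mathbf 1$ is the all-ones matrix; $e^{(i)}$ is the matrix with $i$-th row all ones and zeros elsewhere; $\tilde e^{(j)}$ is the matrix with $j$-th column all ones and zeros elsewhere. $\sigma^2=(\sigma_{ij}^2)_{ij}$ is the vector of variances and $\|\sigma\|^2=\sum_{i,j}\sigma_{ij}^2$. $\kappa_i=\langle k,e^{(i)}\rangle$, $\tilde\kappa_j=\langle k,\tilde e^{(j)}\rangle$. Switch model (discrete time). There are $n^2$ queues with nonnegative integer lengths $q_{ij}(t)$. In each slot $t$, $a_{ij}(t)$ packets (a nonnegative integer $\le a_{\max}$) arrive to queue $(i,j)$; the arrivals are i.i.d. over $t$, independent across queues, independent of queue lengths and schedules, with mean $\lambda_{ij}$ and variance $\sigma_{ij}^2$. A schedule is $s\in\mathcal S=\{s\in\{0,1\}^{n^2}:\sum_i s_{ij}\le1\ \forall j,\ \sum_j s_{ij}\le1\ \forall i\}$. Given $q(t)$, a schedule $s(t)$ is chosen, then arrivals occur, and $q_{ij}(t+1)=\max(0,q_{ij}(t)+a_{ij}(t)-s_{ij}(t))$.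 The MaxWeight algorithm chooses $s(t)\in\arg\max_{s\in\mathcal S}\langle q(t),s\rangle$, ties broken uniformly at random (without changing the dynamics, one takes $s(t)$ to be maximal, i.e. a permutation matrix). The queue length process $q^{(\epsilon)}(t)$ of each system is positive recurrent and converges in distribution to $\bar q^{(\epsilon)}$. Only those $\epsilon$ are considered for which $\lambda^{(\epsilon)}$ is a nonnegative vector. *)

(* Defs.v *)
From mathcomp Require Export all_boot all_order all_algebra finmap.
From mathcomp Require Export all_classical all_reals all_analysis.

Set Implicit Arguments.
Unset Strict Implicit.
Unset Printing Implicit Defensive.

Import Order.TTheory GRing.Theory Num.Theory.
Import numFieldNormedType.Exports.

Local Open Scope classical_set_scope.
Local Open Scope ring_scope.

Section Matrices.
Variables (R : realType) (n : nat).
Implicit Types x y : 'M[R]_n.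

Definition inner x y : R := \sum_(i < n) \sum_(j < n) x i j * y i j.

(* The Euclidean norm; the library norm on matrices is the sup norm. *)
Definition norm2 x : R := Num.sqrt (inner x x).

Definition row_ones (i : 'I_n) : 'M[R]_n := \matrix_(i', j') (i' == i)%:R.

Definition col_ones (j : 'I_n) : 'M[R]_n := \matrix_(i', j') (j' == j)%:R.

(* For 0 < n this infimum ranges over a nonempty finite set, so it is attained. *)
Definition min_entry x : R := inf (range (fun p : 'I_n * 'I_n => x p.1 p.2)).

Definition natmx (q : 'M[nat]_n) : 'M[R]_n := map_mx (fun m => m%:R) q.

(* The parameters at which the family of switches is considered. *)
Definition admissible (nu k : 'M[R]_n) (e : R) : Prop :=
  0 < e < 1 /\ forall i j, 0 <= (nu - e *: k) i j.

End Matrices.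

Section Schedules.
Variable n : nat.
Implicit Types (q : 'M[nat]_n) (s : 'M[bool]_n).

Definition is_schedule s : bool :=
  [forall j, (\sum_(i < n) s i j <= 1)%N] &&
  [forall i, (\sum_(j < n) s i j <= 1)%N].

Definition is_perm_schedule s : bool :=
  [forall j, (\sum_(i < n) s i j == 1)%N] &&
  [forall i, (\sum_(j < n) s i j == 1)%N].

Definition weight q s : nat := (\sum_(i < n) \sum_(j < n) q i j * s i j)%N.

(* The maximal schedules among the maximizers of the weight over all
   schedules. *)
Definition maxweight q : {set 'M[bool]_n} :=
  [set s | is_perm_schedule s &&
     [forall s', is_schedule s' ==> (weight q s' <= weight q s)%N]].

End Schedules.

Section DiscreteProbability.
Variables (d : measure_display) (T : measurableType d) (R : realType).
Variable P : probability T R.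

(* All random elements below take values in countable sets carrying the
   discrete sigma-algebra, in which every subset is measurable. *)
Definition discrete_rv (V : Type) (X : T -> V) : Prop :=
  forall B : set V, measurable (X @^-1` B).

Definition independent_rv (V W : Type) (X : T -> V) (Y : T -> W) : Prop :=
  forall (B : set V) (C : set W),
    P (X @^-1` B `&` Y @^-1` C) = (P (X @^-1` B) * P (Y @^-1` C))%E.

Definition mutually_independent (I : choiceType) (V : Type)
    (X : I -> T -> V) : Prop :=
  forall (J : {fset I}) (B : I -> set V),
    P (\bigcap_(i in [set` J]) X i @^-1` B i) =
    (\prod_(i <- J) P (X i @^-1` B i))%E.

End DiscreteProbability.

(* Convergence in distribution of elements of a discrete space, on which every
   real function is continuous. *)
Definition cvg_in_distribution (R : realType) (V : Type)
    (d : measure_display) (T : measurableType d) (P : probability T R)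
    (X : nat -> T -> V)
    (d' : measure_display) (T' : measurableType d') (P' : probability T' R)
    (Y : T' -> V) : Prop :=
  forall f : V -> R, (exists M, forall v, `|f v| <= M) ->
    ('E_P[f \o X t])%E @[t --> \oo] --> ('E_P'[f \o Y])%E.

Section Switch.
Variables (d : measure_display) (T : measurableType d) (R : realType).
Variable n : nat.
Variables (a q : nat -> T -> 'M[nat]_n) (s : nat -> T -> 'M[bool]_n).

(* What has been observed when the schedule of slot t is chosen. *)
Definition history (t : nat) (w : T) :
    ('I_t -> 'M[nat]_n * 'M[bool]_n * 'M[nat]_n) * 'M[nat]_n :=
  (fun r : 'I_t => (q r w, s r w, a r w), q t w).

(* The variances are given through their square roots sigma i j. *)
Record maxweight_switch (P : probability T R) (amax : nat)
    (lambda sigma : 'M[R]_n) : Prop := MaxweightSwitch {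
  arrival_rv : forall t, discrete_rv (a t);
  queue_rv : forall t, discrete_rv (q t);
  schedule_rv : forall t, discrete_rv (s t);
  arrival_bounded : forall t w i j, (a t w i j <= amax)%N;
  arrival_independent :
    mutually_independent P
      (fun (u : nat * 'I_n * 'I_n) w => a u.1.1 w u.1.2 u.2);
  arrival_identical : forall t t' i j (m : nat),
    P [set w | a t w i j = m] = P [set w | a t' w i j = m];
  arrival_exogenous : forall t,
    independent_rv P (a t) (fun w => (history t w, s t w));
  arrival_mean : forall t i j,
    ('E_P[fun w => (a t w i j)%:R] = (lambda i j)%:E)%E;
  arrival_variance : forall t i j,
    ('V_P[fun w => (a t w i j)%:R] = (sigma i j ^+ 2)%:E)%E;
  (* Given the history, s t is uniformly distributed on maxweight (q t). *)
  schedule_maxweight : forall t A x s0,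
    P (history t @^-1` A `&` q t @^-1` [set x] `&` s t @^-1` [set s0]) =
    (((s0 \in maxweight x)%:R / #|maxweight x|%:R)%:E *
     P (history t @^-1` A `&` q t @^-1` [set x]))%E;
  (* The subtraction of natural numbers is truncated at 0. *)
  queue_update : forall t w i j,
    q t.+1 w i j = (q t w i j + a t w i j - s t w i j)%N
}.

End Switch.

(* Main.v *)
Require Import Defs.
From mathcomp Require Import all_boot all_order all_algebra finmap.
From mathcomp Require Import all_classical all_reals all_analysis.
From mathcomp Require Import measurable_realfun.
From mathcomp Require Import zify ring lra.

(** Weak duality with an integral optimal dual solution (Egervary's theorem,
    by Hall's theorem) shows that a MaxWeight schedule [s] satisfies
    [<q, s - nu> >= nu_min * |q - c|] for some matrix [c] of the cone
    [c i j = w i + v j] with [w, v >= 0].  Hence the squared distance [D] to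
    this cone has drift of order [- sqrt D], uniformly in [e]; the Lyapunov
    function [D ^ 2] bounds the stationary mean of [D] independently of [e].
    The fourth power of the norm is a Lyapunov function for fixed [e], so that
    all quadratic functions have drift zero in steady state.  For
    [f q = <q, L q>], with [L] the projection onto the span of the cone, the
    drift is [- (2 e / n) <q, alpha> + (2 / n - 1 / n ^ 2) |sigma| ^ 2] up to
    [e ^ 2], a multiple of [e * sqrt D], and the unused service [u].  As
    [<q+, u> = 0], the latter contributes
    [2 <q+, L u> = 2 <q+ - c+, L u - u> <= sqrt e * D+ + |u| ^ 2 / sqrt e],
    while the mean of [|u| ^ 2] is [e n] because the total queue length is
    stationary.  Dividing by [2 e / n] leaves an error [O(1 / sqrt e)]. *)

Set Implicit Arguments.
Unset Strict Implicit.
Unset Printing Implicit Defensive.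

Import Order.TTheory GRing.Theory Num.Theory.
Import numFieldNormedType.Exports.

Local Open Scope classical_set_scope.
Local Open Scope ring_scope.

(** * Hall's theorem and Egervary's duality *)

Section Hall.
Variables I J : finType.
Local Open Scope set_scope.
Local Open Scope nat_scope.

Definition hall_condition (A : I -> {set J}) : bool :=
  [forall S : {set I}, #|S| <= #|\bigcup_(i in S) A i|].

Definition shrink (A : I -> {set J}) (i : I) (z : J) (k : I) : {set J} :=
  if k == i then A i :\ z else A k.

Lemma sum_shrink (A : I -> {set J}) i z :
  z \in A i -> \sum_k #|shrink A i z k| < \sum_k #|A k|.
Proof.
move=> zA; rewrite (bigD1 i) //= [ltnRHS](bigD1 i) //= /shrink eqxx.
rewrite (cardsD1 z (A i)) zA add1n addSn ltnS leq_add2l.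
by apply: leq_sum => k /negPf ->.
Qed.

(* Rado's argument: two failures of Hall's condition contradict submodularity. *)
Lemma hall_shrink (A : I -> {set J}) i x y :
  hall_condition A -> x != y ->
  ~~ hall_condition (shrink A i x) -> hall_condition (shrink A i y).
Proof.
move=> /forallP hA xy /forallPn[S]; rewrite -ltnNge => hS.
apply: contraT => /forallPn[U]; rewrite -ltnNge => hU.
(* Off [i] the shrunken family agrees with [A], so a set that violates Hall's condition must contain
   [i]. *)
have inS z (W : {set I}) :
    #|\bigcup_(k in W) shrink A i z k| < #|W| -> i \in W.
  move=> hW; apply: contraTT (hA W) => iW; rewrite -ltnNge.
  rewrite (eq_bigr (shrink A i z)) // => k kW.
  by rewrite /shrink; case: eqP kW iW => // -> ->.
have iS := inS _ _ hS; have iU := inS _ _ hU.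
set BS := \bigcup_(_ in S) _ in hS; set BU := \bigcup_(_ in U) _ in hU.
(* As [x != y], every element of [A i] survives in one of the two shrunken families. *)
have sub1 : \bigcup_(k in S :|: U) A k \subset BS :|: BU.
  apply/finset.bigcupsP => k kSU; apply/fintype.subsetP => z zA; rewrite inE.
  have [ki|ki] := eqVneq k i.
    rewrite ki in zA; have [zx|zx] := eqVneq z x.
      apply/orP; right; apply/finset.bigcupP; exists i => //.
      by rewrite /shrink eqxx !inE zA zx xy.
    apply/orP; left; apply/finset.bigcupP; exists i => //.
    by rewrite /shrink eqxx !inE zA zx.
  move: kSU; rewrite inE => /orP[kS|kU]; apply/orP; [left|right];
    by apply/finset.bigcupP; exists k => //; rewrite /shrink (negPf ki).
have sub2 : \bigcup_(k in (S :&: U) :\ i) A k \subset BS :&: BU.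
  apply/finset.bigcupsP => k; rewrite !inE => /and3P[ki kS kU].
  apply/fintype.subsetP => z zA; rewrite inE; apply/andP.
  by split; apply/finset.bigcupP; exists k => //; rewrite /shrink (negPf ki).
(* Together [BS] and [BU] have at least [#|S| + #|U| - 1] elements, whereas the two failures allow
   at most [#|S| + #|U| - 2]. *)
have := leq_trans (hA _) (subset_leq_card sub1).
have := leq_trans (hA _) (subset_leq_card sub2).
have := cardsUI BS BU; have := cardsUI S U.
have := cardsD1 i (S :&: U); rewrite inE iS iU /=; lia.
Qed.

(** Induction on the total size of the family: while some set has two elements, one of them can be
    deleted without losing Hall's condition. *)
Lemma hall (A : I -> {set J}) :
  hall_condition A -> exists2 f : I -> J, injective f & forall i, f i \in A i.
Proof.
have [m] := ubnP (\sum_i #|A i|); elim: m A => // m IHm A hm hA.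
have [/existsP[i /card_gt1P[x [y [xA yA xy]]]]|/existsPn small] :=
  boolP [exists i, 1 < #|A i|].
  have step z : z \in A i -> hall_condition (shrink A i z) ->
      exists2 f : I -> J, injective f & forall i, f i \in A i.
    move=> zA hz; have [|f finj fA] := IHm _ _ hz.
      by have := sum_shrink zA; lia.
    exists f => // k; have := fA k; rewrite /shrink.
    by case: eqP => // ->; rewrite !inE => /andP[].
  have [hx|hx] := boolP (hall_condition (shrink A i x)); first exact: step hx.
  exact: step yA (hall_shrink hA xy hx).
(* No set has two elements any more. The condition on one index makes each set a singleton, and on
   two indices it gives injectivity. *)
have A1 i : {f | A i = [set f]}.
  have /eqP/cards1P/cid[f ->] : #|A i| = 1; last by exists f.
  have := forallP hA [set i]; rewrite big_set1 cards1.
  by have := small i; lia.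
exists (fun i => sval (A1 i)); last by move=> i; case: (A1 i) => f /= ->; rewrite inE.
move=> i j; case: (A1 i) (A1 j) => f Af [g Ag] /= fg.
apply: contraTeq (forallP hA [set i; j]) => ij.
by rewrite -ltnNge cards2 ij finset.bigcup_setU !big_set1 Af Ag fg finset.setUid cards1.
Qed.

End Hall.

Section Egervary.
Variable n : nat.
Local Open Scope set_scope.
Local Open Scope nat_scope.
Implicit Types (x : 'M[nat]_n) (s : 'M[bool]_n) (w v : 'I_n -> nat).

(** Primal-dual descent on the value of an integral cover [w], [v]. If the tight entries contain a
    perfect matching, it is the schedule; otherwise a set of rows violating Hall's condition yields
    a cover of smaller value. *)
Lemma egervary x : exists w v s,
  [/\ forall i j, x i j <= w i + v j, is_perm_schedule s
    & forall i j, s i j -> x i j = w i + v j].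
Proof.
suff main N w v : (forall i j, x i j <= w i + v j) ->
    \sum_i w i + \sum_j v j < N -> exists w v s,
    [/\ forall i j, x i j <= w i + v j, is_perm_schedule s
      & forall i j, s i j -> x i j = w i + v j].
  apply: (main _ (fun i => \sum_j x i j) (fun=> 0)) (ltnSn _) => i j.
  by rewrite addn0 (bigD1 j) //= leq_addr.
elim: N w v => // N IHN w v cov wvN.
pose A i := [set j | x i j == w i + v j]%SET.
have [hA|/forallPn[S]] := boolP (hall_condition A).
  have [f finj fA] := hall hA.
  exists w, v, (\matrix_(i, j) (f i == j)); split => //.
    apply/andP; split; apply/forallP => i.
      have [g fK gK] := injF_bij finj.
      rewrite (bigD1 (g i)) //= mxE gK eqxx big1 // => k ki; rewrite mxE.
      by case: eqP => // fk; rewrite -fk fK eqxx in ki.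
    rewrite (bigD1 (f i)) //= mxE eqxx big1 // => k ki.
    by rewrite mxE eq_sym (negPf ki).
  by move=> i j; rewrite mxE => /eqP <-; have := fA i; rewrite inE => /eqP.
rewrite -ltnNge; set NS := \bigcup_(_ in S) _ => hS.
(* In both updates below the value of the cover drops by [#|S| - #|NS|]. *)
have arith a b c e m r t : a + r = c + m -> b + m = e + t -> t < r ->
  c + e < N.+1 -> a + b < N by lia.
have slack i j : i \in S -> j \notin NS -> x i j < w i + v j.
  move=> iS jN; rewrite ltn_neqAle cov andbT.
  by apply: contra jN => xe; apply/finset.bigcupP; exists i => //; rewrite inE.
have card_sum (B : {set 'I_n}) : #|B| = \sum_i (i \in B).
  by rewrite -sum1_card big_mkcond; apply: eq_bigr => i _; case: (i \in B).
(* The usual update lowers [w] on [S] and raises [v] on [NS]. If some weight on [S] is 0, the update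
   is shifted by 1: [w] rises off [S] and [v] falls off [NS], where the slack in row [i0] forces
   [v j > 0]. *)
have [/existsP[i0 /andP[i0S /eqP wi0]]|/existsPn wpos] :=
  boolP [exists i, (i \in S) && (w i == 0)].
  have vpos j : j \notin NS -> 0 < v j.
    by move=> jN; have := slack _ _ i0S jN; rewrite wi0; lia.
  apply: (IHN (fun i => w i + (i \notin S)) (fun j => v j - (j \notin NS))).
    move=> i j; have := cov i j; have := slack i j; have := vpos j.
    by case: (i \in S); case: (j \in NS) => /=; lia.
  have sw : \sum_i (w i + (i \notin S)) + #|S| = \sum_i w i + \sum_(i < n) 1.
    rewrite card_sum -!big_split /=.
    by apply: eq_bigr => i _; case: (i \in S) => /=; lia.
  have sv : \sum_j (v j - (j \notin NS)) + \sum_(i < n) 1 = \sum_j v j + #|NS|.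
    rewrite card_sum -!big_split /=.
    by apply: eq_bigr => j _ /=; have := vpos j; case: (j \in NS) => /=; lia.
  exact: arith sw sv hS wvN.
have wpos' i : i \in S -> 0 < w i by move=> iS; have := wpos i; rewrite iS; lia.
apply: (IHN (fun i => w i - (i \in S)) (fun j => v j + (j \in NS))).
  move=> i j; have := cov i j; have := slack i j; have := wpos' i.
  by case: (i \in S); case: (j \in NS) => /=; lia.
have sw : \sum_i (w i - (i \in S)) + #|S| = \sum_i w i.
  rewrite card_sum -big_split /=.
  by apply: eq_bigr => i _; have := wpos' i; case: (i \in S) => /=; lia.
have sv : \sum_j (v j + (j \in NS)) = \sum_j v j + #|NS|.
  by rewrite card_sum -big_split.
by apply: (arith _ _ _ _ 0 _ _ _ _ hS wvN); rewrite ?addn0 ?sw ?sv.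
Qed.

(** Weak duality: the row and column sums of a schedule are at most 1. *)
Lemma weight_cover x s w v : is_schedule s ->
  (forall i j, x i j <= w i + v j) -> weight x s <= \sum_i w i + \sum_j v j.
Proof.
move=> /andP[/forallP sc /forallP sr] cov.
apply: (@leq_trans (\sum_i \sum_j (w i + v j) * s i j)).
  by do 2!apply: leq_sum => ? _; rewrite leq_mul.
under eq_bigr do under eq_bigr do rewrite mulnDl.
under eq_bigr do rewrite big_split.
rewrite big_split leq_add //=; last rewrite exchange_big /=;
  by apply: leq_sum => i _; rewrite -big_distrr /= -[leqRHS]muln1 leq_mul.
Qed.

Lemma perm_is_schedule s : is_perm_schedule s -> is_schedule s.
Proof.
by move=> /andP[/forallP sc /forallP sr]; apply/andP; split; apply/forallP => i;
  rewrite (eqP (sc i)) || rewrite (eqP (sr i)).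
Qed.

(** Complementary slackness: the schedule uses only tight entries, and each row and each column
    once. *)
Lemma weight_perm x s w v : is_perm_schedule s ->
  (forall i j, s i j -> x i j = w i + v j) ->
  weight x s = \sum_i w i + \sum_j v j.
Proof.
move=> /andP[/forallP sc /forallP sr] tight.
transitivity (\sum_i \sum_j (w i + v j) * s i j).
  apply: eq_bigr => i _; apply: eq_bigr => j _.
  by case: (boolP (s i j)) => [/tight -> //|_] /=; rewrite !muln0.
under eq_bigr do under eq_bigr do rewrite mulnDl.
under eq_bigr do rewrite big_split.
rewrite big_split; congr (_ + _).
  by apply: eq_bigr => i _; rewrite -big_distrr /= (eqP (sr i)) muln1.
rewrite exchange_big; apply: eq_bigr => j _.
by rewrite -big_distrr /= (eqP (sc j)) muln1.
Qed.

(** Strong duality: the schedule of [egervary] competes with [s], and weak duality bounds [s] by the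
    same value. *)
Lemma maxweight_cover x s : s \in maxweight x -> exists w v,
  (forall i j, x i j <= w i + v j) /\ weight x s = \sum_i w i + \sum_j v j.
Proof.
rewrite inE => /andP[sp /forallP smax].
have [w [v [s0 [cov s0p tight]]]] := egervary x.
exists w, v; split => //; apply/eqP; rewrite eqn_leq.
rewrite weight_cover ?perm_is_schedule //= -(weight_perm s0p tight).
by have := implyP (smax s0); apply; exact: perm_is_schedule.
Qed.

Lemma maxweight_gt0 x : 0 < #|maxweight x|.
Proof.
have [w [v [s [cov sp tight]]]] := egervary x.
apply/card_gt0P; exists s; rewrite inE sp; apply/forallP => s'.
by apply/implyP => s's; rewrite (weight_perm sp tight) weight_cover.
Qed.

End Egervary.

(** * Stationary distributions of finitely supported kernels *)

Lemma measurable_discrete_rv (d : measure_display) (T : measurableType d)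
    (R : realType) (V : Type) (X : T -> V) (f : V -> R) (D : set T) :
  discrete_rv X -> measurable_fun D (fun w => (f (X w))%:E).
Proof.
move=> dX mD B _; apply: measurableI => //.
exact: (dX [set v | B (f v)%:E]).
Qed.

Section CountableConditioning.
Variables (d : measure_display) (T : measurableType d) (R : realType).
Variables (P : probability T R) (V : countType) (X : T -> V).
Hypothesis dX : discrete_rv X.
Local Open Scope ereal_scope.

(** The set [A] splits into the countably many fibres of [X], indexed by the codes of the values; a
    number that codes no value contributes 0. *)
Lemma integral_discrete_rv (A : set T) (h : V -> R) : measurable A ->
  (forall v, 0 <= h v)%R ->
  \int[P]_(w in A) (h (X w))%:E =
  \sum_(i <oo) oapp (fun x => (h x)%:E * P (X @^-1` [set x] `&` A)) 0
                    (@pickle_inv V i).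
Proof.
move=> mA h0.
pose F i := X @^-1` [set x | choice.pickle x = i] `&` A.
have AF : A = \bigcup_i F i.
  apply/seteqP; split=> [w Aw|w [i _ []] //].
  by exists (choice.pickle (X w)) => //; split.
have mF i : measurable (F i) by apply: measurableI => //; exact: dX.
rewrite {1}AF ge0_integral_bigcup //; last first.
- move=> i j _ _ [w [[/= wi _] [/= wj _]]]; by rewrite -wi -wj.
- by move=> w _; rewrite lee_fin.
- exact: (measurable_discrete_rv h).
apply: eq_eseriesr => i _.
case Ei: (@pickle_inv V i) => [x|] /=.
  have xi : choice.pickle x = i by have := @pickle_invK V i; rewrite Ei.
  have FE : F i = X @^-1` [set x] `&` A.
    apply/seteqP; split=> w [/= wi Aw]; split=> //=.
      by apply: (pcan_inj (@choice.pickleK V)); rewrite xi.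
    by rewrite wi.
  rewrite -FE -integral_cst //; apply: eq_integral => w.
  by rewrite FE inE => -[/= -> _].
rewrite (_ : F i = set0) ?integral_set0 //.
apply/seteqP; split=> // w [/= wi _].
by have := pickleK_inv (X w); rewrite wi Ei.
Qed.

(** Here [c x] is the conditional probability of [A] given [X = x]. *)
Lemma integral_conditional (A : set T) (c h : V -> R) : measurable A ->
  (forall v, 0 <= c v)%R -> (forall v, 0 <= h v)%R ->
  (forall x, P (X @^-1` [set x] `&` A) = (c x)%:E * P (X @^-1` [set x])) ->
  \int[P]_(w in A) (h (X w))%:E = \int[P]_w (c (X w) * h (X w))%:E.
Proof.
move=> mA c0 h0 cA.
rewrite integral_discrete_rv // (@integral_discrete_rv setT (fun v => c v * h v)%R) //.
  apply: eq_eseriesr => i _; case: (@pickle_inv V i) => //= x.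
  by rewrite cA setIT EFinM muleCA muleA.
by move=> v; rewrite mulr_ge0.
Qed.

(** Law of total expectation: [w x] is the conditional law of [Z] given [X = x], and the integral is
    split over the finitely many values of [Z]. *)
Lemma integral_kernel (O : finType) (Z : T -> O) (w : V -> O -> R)
    (step : V -> O -> V) (f : V -> R) :
  (forall o, measurable (Z @^-1` [set o])) ->
  (forall v o, 0 <= w v o)%R -> (forall v, 0 <= f v)%R ->
  (forall x o, P (X @^-1` [set x] `&` Z @^-1` [set o]) =
               (w x o)%:E * P (X @^-1` [set x])) ->
  \int[P]_t (f (step (X t) (Z t)))%:E =
  \int[P]_t (\sum_o w (X t) o * f (step (X t) o))%:E.
Proof.
move=> mZ w0 f0 wZ.
transitivity (\int[P]_t \sum_o (((fun t => (f (step (X t) o))%:E) \_ (Z @^-1` [set o])) t)).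
  apply: eq_integral => t _.
  rewrite (bigD1 (Z t)) //= big1 ?adde0 ?patchE ?mem_set //= => o oZ.
  by rewrite patchE memNset //= => oZ'; rewrite oZ' eqxx in oZ.
rewrite ge0_integral_sum //; last 2 first.
- move=> o; apply/(measurable_restrict _ (mZ o)) => //; rewrite setTI.
  by apply: (measurable_discrete_rv (fun x => f (step x o))).
- by move=> o t _; rewrite erestrict_ge0 // => *; rewrite lee_fin.
transitivity (\sum_o \int[P]_t (w (X t) o * f (step (X t) o))%:E).
  apply: eq_bigr => o _; rewrite -integral_mkcond.
  exact: (@integral_conditional _ (w^~ o) (fun x => f (step x o))).
rewrite -ge0_integral_sum //; last 2 first.
- by move=> o; apply: (measurable_discrete_rv (fun x => w x o * f (step x o))%R).
- by move=> o t _; rewrite lee_fin mulr_ge0.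
by apply: eq_integral => t _; rewrite sumEFin.
Qed.

End CountableConditioning.

(** The action on functions of the transition kernel that draws [o] with weights [w x] and moves [x]
    to [step x o]. *)
Definition average (R : realType) (V : Type) (O : finType) (w : V -> O -> R)
  (step : V -> O -> V) (f : V -> R) (x : V) : R := \sum_o w x o * f (step x o).

(** * Foster-Lyapunov bounds and invariance for unbounded functions *)

Section Stationary.
Variables (d : measure_display) (T : measurableType d) (R : realType).
Variables (P : probability T R) (V : Type) (X : T -> V).
Hypothesis dX : discrete_rv X.
Variables (O : finType) (w : V -> O -> R) (step : V -> O -> V).
Hypothesis w0 : forall v o, 0 <= w v o.
Hypothesis w1 : forall v, \sum_o w v o = 1.
Notation K := (average w step).

Lemma average_ge0 f : (forall v, 0 <= f v) -> forall v, 0 <= K f v.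
Proof. by move=> f0 v; rewrite sumr_ge0 // => o _; rewrite mulr_ge0. Qed.

Lemma le_average f g x :
  (forall o, 0 < w x o -> f (step x o) <= g (step x o)) -> K f x <= K g x.
Proof.
move=> fg; apply: ler_sum => o _; have := w0 x o.
rewrite le_eqVlt => /orP[/eqP <-|wpos]; first by rewrite !mul0r.
by rewrite ler_pM2l // fg.
Qed.

Lemma average_cst c x : K (fun=> c) x = c.
Proof. by rewrite /average -mulr_suml w1 mul1r. Qed.

Lemma averageD f g x : K (fun v => f v + g v) x = K f x + K g x.
Proof. by rewrite /average -big_split; apply: eq_bigr => o _; rewrite mulrDr. Qed.

Lemma averageZ c f x : K (fun v => c * f v) x = c * K f x.
Proof. by rewrite /average mulr_sumr; apply: eq_bigr => o _; rewrite mulrCA. Qed.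

(** Only bounded functions are tested, since this is what convergence in distribution delivers;
    [stationary_ge0] removes the bound. *)
Definition stationary : Prop := forall f : V -> R,
  (forall v, 0 <= f v) -> (exists M, forall v, f v <= M) ->
  (\int[P]_t (f (X t))%:E = \int[P]_t (K f (X t))%:E)%E.

Hypothesis stat : stationary.

Lemma integral_probability_cst (c : R) : (\int[P]_t c%:E = c%:E)%E.
Proof.
transitivity (c%:E * P setT)%E; first exact: (integral_cst P measurableT c%:E).
by rewrite probability_setT mule1.
Qed.

Lemma bounded_integral_fin (f : V -> R) M :
  (forall v, 0 <= f v) -> (forall v, f v <= M) ->
  (\int[P]_t (f (X t))%:E)%E \is a fin_num.
Proof.
move=> f0 fM; rewrite ge0_fin_numE; last first.
  by apply: integral_ge0 => t _; rewrite lee_fin.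
apply: (@le_lt_trans _ _ (\int[P]_t M%:E)%E).
  apply: ge0_le_integral => //; try exact: (measurable_discrete_rv f).
  - by move=> t _; rewrite lee_fin.
  - by move=> t _ /=; rewrite lee_fin.
by rewrite integral_probability_cst ltry.
Qed.

(* Truncation at level M makes the Lyapunov function L bounded; the drift of
   the truncated function is nonpositive above the level M. *)
Lemma foster_lyapunov (L g : V -> R) (b : R) :
  (forall v, 0 <= L v) -> (forall v, 0 <= g v) -> 0 <= b ->
  (forall v, K L v <= L v - g v + b) ->
  (\int[P]_t (g (X t))%:E <= b%:E)%E.
Proof.
move=> L0 g0 b0 drift.
pose gt M v := if L v <= M then g v else 0.
have gt0 M v : 0 <= gt M v by rewrite /gt; case: ifP.
have trunc (M : R) : 0 <= M -> (\int[P]_t (gt M (X t))%:E <= b%:E)%E.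
  move=> M0; pose LM v := Num.min (L v) M.
  have LM0 v : 0 <= LM v by rewrite le_min L0.
  have LMM v : LM v <= M by rewrite ge_min lexx orbT.
  have fin := bounded_integral_fin LM0 LMM.
  have mf f : measurable_fun [set: T] (fun t => (f (X t))%:E : \bar R).
    by apply: (measurable_discrete_rv f).
  have K0 := average_ge0 LM0.
  (* The mean of [LM] is finite and equals that of [K LM], so it cancels; writing it on both sides
     keeps all integrands nonnegative. *)
  suff : (\int[P]_t (gt M (X t))%:E + \int[P]_t (K LM (X t))%:E <=
          \int[P]_t b%:E + \int[P]_t (LM (X t))%:E)%E.
    by rewrite -(stat LM0 (ex_intro _ M LMM)) integral_probability_cst leeD2rE.
  rewrite -!ge0_integralD //; try by move=> t _; rewrite lee_fin.
  apply: ge0_le_integral => //; try by [move=> t _; rewrite lee_fin addr_ge0].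
  - by apply: emeasurable_funD; exact: mf.
  - by apply: emeasurable_funD => //; exact: mf.
  move=> t _; rewrite -!EFinD lee_fin /gt; set v := X t.
  case: ifPn => LvM.
    have : K LM v <= K L v.
      by apply: le_average => o _; rewrite ge_min lexx.
    have -> : LM v = L v by rewrite /LM min_l.
    by have := drift v; lra.
  have -> : LM v = M by rewrite /LM min_r // ltW // ltNge.
  have : K LM v <= K (fun=> M) v by apply: le_average => o _; exact: LMM.
  by rewrite average_cst; lra.
(* Monotone convergence as the truncation level tends to infinity. *)
pose gn (m : nat) t := (gt m%:R (X t))%:E.
have gn_cvg : (\int[P]_t gn m t @[m --> \oo] --> \int[P]_t (g (X t))%:E)%E.
  rewrite [X in _ --> X](_ : _ = \int[P]_t lim (gn m t @[m --> \oo]))%E; last first.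
    apply: eq_integral => t _; apply/esym/cvg_lim => //.
    apply: cvg_near_cst; exists (Num.truncn (L (X t))).+1 => // m /= Lm.
    rewrite /gn /gt; case: ifPn => //; rewrite -ltNge => mL.
    have := truncnS_gt (L (X t)); rewrite ltNge (le_trans _ (ltW mL)) //.
    by rewrite ler_nat.
  apply: cvg_monotone_convergence => //.
  - by move=> m; apply: (measurable_discrete_rv (fun v => gt m%:R v)).
  - by move=> m t _; rewrite lee_fin.
  - move=> t _ m m' mm'; rewrite lee_fin /gt; case: ifPn => Lm.
      by rewrite (le_trans Lm) // ler_nat.
    by case: ifP.
rewrite -(cvg_lim _ gn_cvg) //; apply: lime_le; first by apply/cvg_ex; eexists; exact: gn_cvg.
by apply: nearW => m; apply: trunc.
Qed.

(** Truncation at level [m] and monotone convergence on both sides; both integrals may be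
    infinite. *)
Lemma stationary_ge0 (f : V -> R) : (forall v, 0 <= f v) ->
  (\int[P]_t (f (X t))%:E = \int[P]_t (K f (X t))%:E)%E.
Proof.
move=> f0; pose fm (m : nat) v := Num.min (f v) m%:R.
have fm0 m v : 0 <= fm m v by rewrite le_min f0 ler0n.
have fm_le m m' v : (m <= m')%N -> fm m v <= fm m' v.
  move=> mm'; rewrite /fm le_min !ge_min lexx /=; apply/orP; right.
  by rewrite ler_nat.
have fm_cst v : \forall m \near \oo, fm m v = f v.
  exists (Num.truncn (f v)).+1 => // m /= Lm.
  rewrite /fm min_l // (le_trans (ltW (truncnS_gt _))) //.
  by rewrite ler_nat.
have cvg1 (F : nat -> V -> R) (G : V -> R) :
    (forall m v, 0 <= F m v) -> (forall m m' v, (m <= m')%N -> F m v <= F m' v) ->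
    (forall v, \forall m \near \oo, F m v = G v) ->
    (\int[P]_t (F m (X t))%:E @[m --> \oo] --> \int[P]_t (G (X t))%:E)%E.
  move=> F0 Fle FG.
  rewrite [X in _ --> X](_ : _ = \int[P]_t lim ((F m (X t))%:E @[m --> \oo]))%E; last first.
    apply: eq_integral => t _; apply/esym/cvg_lim => //.
    apply: cvg_near_cst; near=> m; congr EFin; near: m; exact: FG.
  apply: cvg_monotone_convergence => //.
  - by move=> m; apply: (measurable_discrete_rv (fun v => F m v)).
  - by move=> m t _; rewrite lee_fin.
  - by move=> t _ m m' mm'; rewrite lee_fin Fle.
have c1 := cvg1 fm f fm0 fm_le fm_cst.
have c2 : (\int[P]_t (fm m (X t))%:E @[m --> \oo] --> \int[P]_t (K f (X t))%:E)%E.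
  have E : (fun m => \int[P]_t (fm m (X t))%:E)%E = (fun m => \int[P]_t (K (fm m) (X t))%:E)%E.
    apply/funext => m; apply: stat => //.
    by exists m%:R => v; rewrite ge_min lexx orbT.
  rewrite E.
  apply: (cvg1 (fun m => K (fm m))).
  - by move=> m; exact: average_ge0.
  - by move=> m m' v mm'; apply: le_average => o _; exact: fm_le.
  - move=> v; have H : \forall m \near \oo, forall o, fm m (step v o) = f (step v o).
      by apply: filter_forall => o; exact: fm_cst.
    near=> m; apply: eq_bigr => o _; congr (_ * _); move: o; near: m; exact: H.
by rewrite -(cvg_lim _ c1) // -(cvg_lim _ c2).
Unshelve. all: by end_near. Qed.

End Stationary.

(** * Moment bounds and stationary means from drift inequalities *)

Section Moments.
Variables (d : measure_display) (T : measurableType d) (R : realType).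
Variables (P : probability T R) (V : Type) (X : T -> V).
Hypothesis dX : discrete_rv X.
Variables (O : finType) (w : V -> O -> R) (step : V -> O -> V).
Hypothesis w0 : forall v o, 0 <= w v o.
Hypothesis w1 : forall v, \sum_o w v o = 1.
Notation K := (average w step).
Hypothesis stat : stationary P X w step.

(** With [t = (10 B + 1) / (4 c)], the function [(10 B + 1) y^2 - 4 c y^3] of [y >= 0] is at most
    [(10 B + 1) t^2]; the term [2 B^2] is the constant in the drift of [D ^+ 2]. *)
Definition moment_constant (c B : R) : R :=
  (10 * B + 1) * ((10 * B + 1) / (4 * c)) ^+ 2 + 2 * B ^+ 2.

(* The Lyapunov function is [D ^+ 2]: a drift of order [- sqrt D] for [D]
   is a drift of order [- D * sqrt D] for its square. *)
Lemma lyapunov_moment (D : V -> R) (ip : V -> O -> R) (c B : R) :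
  0 < c -> 0 <= B -> (forall v, 0 <= D v) ->
  (forall v o, 0 < w v o -> D (step v o) <= D v + 2 * ip v o + B) ->
  (forall v o, 0 < w v o -> ip v o ^+ 2 <= B * D v) ->
  (forall v, \sum_o w v o * ip v o <= - (c * Num.sqrt (D v))) ->
  (\int[P]_t (D (X t))%:E <= (moment_constant c B)%:E)%E.
Proof.
move=> c0 B0 D0 Dstep ipB drift.
apply: (@foster_lyapunov _ _ _ P _ X dX _ w step w0 w1 stat (fun v => D v ^+ 2) D _) => //.
- by move=> v; rewrite sqr_ge0.
- by rewrite /moment_constant addr_ge0 // mulr_ge0 ?sqr_ge0 // addr_ge0 // mulr_ge0.
move=> v; set y := Num.sqrt (D v).
have y0 : 0 <= y by exact: sqrtr_ge0.
have Dy : D v = y ^+ 2 by rewrite sqr_sqrtr.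
(* In the square of [D + 2 ip + B], the bounds [4 ip^2 <= 4 B D] and [4 B ip <= 4 ip^2 + B^2] raise
   the coefficient of [D] from [2 B] to [10 B]. *)
have step1 : K (fun v => D v ^+ 2) v <=
    \sum_o w v o * (D v ^+ 2 + 10 * B * D v + 2 * B ^+ 2 + (4 * D v) * ip v o).
  apply: ler_sum => o _; have := w0 v o.
  rewrite le_eqVlt => /orP[/eqP <-|wpos]; first by rewrite !mul0r.
  rewrite ler_pM2l //.
  have h1 := Dstep v o wpos; have h2 := ipB v o wpos; have h3 := D0 (step v o).
  apply: (@le_trans _ _ ((D v + 2 * ip v o + B) ^+ 2)).
    by rewrite ler_sqr ?nnegrE // (le_trans h3).
  have := sqr_ge0 (2 * ip v o - B); nra.
apply: (le_trans step1).
have -> A b : \sum_o w v o * (A + b * ip v o) = A + b * \sum_o w v o * ip v o.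
  rewrite [in RHS]mulr_sumr -[in RHS](mul1r A) -(w1 v) mulr_suml -big_split.
  by apply: eq_bigr => o _ /=; ring.
have := ler_wpM2l (mulr_ge0 (ler0n R 4) (D0 v)) (drift v).
rewrite -/y; move: (\sum_o _) => S hS.
have D0' := D0 v; have c0' := ltW c0; rewrite /moment_constant; set t := (10 * B + 1) / (4 * c).
have t0 : 0 <= t by rewrite divr_ge0 ?addr_ge0 ?mulr_ge0.
have tc : 10 * B + 1 = 4 * c * t by rewrite /t; field; rewrite gt_eqF.
(* The summand 1 in [10 * B + 1] supplies the drift [- D] that [foster_lyapunov] asks for; beyond
   [y = t] the cubic term dominates. *)
have key : - (4 * c * y ^+ 3) + (10 * B + 1) * y ^+ 2 <= (10 * B + 1) * t ^+ 2.
  have -> : y ^+ 3 = y * y ^+ 2 by ring.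
  rewrite tc; have [yt|/ltW ty] := leP y t.
    have yt2 : y ^+ 2 <= t ^+ 2 by rewrite ler_sqr ?nnegrE.
    have : 0 <= c * t * (t ^+ 2 - y ^+ 2) by rewrite mulr_ge0 ?subr_ge0 // mulr_ge0.
    have : 0 <= c * (y * y ^+ 2) by rewrite !mulr_ge0 ?sqr_ge0.
    lra.
  have h2 : 0 <= c * (y ^+ 2 * (y - t)) by rewrite mulr_ge0 // mulr_ge0 ?sqr_ge0 // subr_ge0.
  have h3 : 0 <= c * (t * t ^+ 2) by do 2!apply: mulr_ge0 => //; exact: sqr_ge0.
  lra.
move: hS key; rewrite Dy; have -> : y ^+ 3 = y * y ^+ 2 by ring.
lra.
Qed.

Lemma integrable_discrete_rv (f : V -> R) (g : V -> R) :
  (forall v, `|f v| <= g v) -> (\int[P]_t (g (X t))%:E < +oo)%E ->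
  P.-integrable setT (EFin \o (f \o X)).
Proof.
move=> fg gfin; apply/integrableP; split; first exact: (measurable_discrete_rv f).
apply: le_lt_trans gfin; apply: ge0_le_integral => //.
- exact: (measurable_discrete_rv (fun v => `|f v|)).
- exact: (measurable_discrete_rv g).
- by move=> t _; rewrite /= lee_fin.
Qed.

Lemma integrable_average (f : V -> R) : (forall v, 0 <= f v) ->
  (\int[P]_t (f (X t))%:E < +oo)%E ->
  P.-integrable setT (EFin \o (K f \o X)) /\
  (\int[P]_t K f (X t) = \int[P]_t f (X t))%R.
Proof.
move=> f0 ffin; split; last by rewrite /Rintegral (stationary_ge0 dX w0 stat f0).
apply: (@integrable_discrete_rv _ (K f)).
  by move=> v; rewrite ger0_norm // (average_ge0 _ w0).
by rewrite -(stationary_ge0 dX w0 stat f0).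
Qed.

(** The differences between [K F1] and [F1] and between [K F2] and [F2] have stationary mean zero.
    Two functions occur because both signs are needed while each function is nonnegative. *)
Lemma stationary_mean_le (h D F1 F2 : V -> R) (c0 c1 C : R) :
  (forall v, 0 <= D v) -> (forall v, 0 <= F1 v) -> (forall v, 0 <= F2 v) ->
  (\int[P]_t (F1 (X t))%:E < +oo)%E -> (\int[P]_t (F2 (X t))%:E < +oo)%E ->
  (\int[P]_t (D (X t))%:E <= C%:E)%E -> 0 <= c1 ->
  P.-integrable setT (EFin \o (h \o X)) ->
  (forall v, h v <= c0 + c1 * D v + (K F1 v - F1 v) + (F2 v - K F2 v)) ->
  (\int[P]_t h (X t) <= c0 + c1 * C)%R.
Proof.
move=> D0 F10 F20 F1fin F2fin DC c10 hint hle.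
have int f : (forall v, 0 <= f v) -> (\int[P]_t (f (X t))%:E < +oo)%E ->
    P.-integrable setT (EFin \o (fun t => f (X t))).
  by move=> f0; apply: (@integrable_discrete_rv f) => v; rewrite ger0_norm.
have iD := int D D0 (le_lt_trans DC (ltry C)).
have i1 := int F1 F10 F1fin; have i2 := int F2 F20 F2fin.
have [iK1 e1] := integrable_average F10 F1fin.
have [iK2 e2] := integrable_average F20 F2fin.
have mT : measurable [set: T] by [].
have ic : P.-integrable setT (EFin \o (fun _ : T => c0)).
  by apply: finite_measure_integrable_cst.
have icD : P.-integrable setT (EFin \o (fun t => c1 * D (X t))).
  by have := integrableZl mT c1 iD.
have ia := integrableD mT ic icD.
have ib := integrableB mT iK1 i1.
have iab := integrableD mT ia ib.
have ie := integrableB mT i2 iK2.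
have iall := integrableD mT iab ie.
apply: (@le_trans _ _ (\int[P]_t ((c0 + c1 * D (X t) + (K F1 (X t) - F1 (X t))) + (F2 (X t) - K F2 (X t))))%R).
  by apply: le_Rintegral => // t _; exact: hle.
rewrite RintegralD // RintegralD // RintegralD // RintegralB // RintegralB //.
rewrite e1 e2 !subrr !addr0 RintegralZl // lerD //.
  by rewrite /Rintegral integral_probability_cst.
rewrite ler_wpM2l // /Rintegral -[leRHS]/(fine C%:E) fine_le //.
by rewrite integrable_fin_num.
Qed.

End Moments.

(** * The transition kernel of the switch *)

Section Kernel.
Variables (R : realType) (n N : nat).

(* The arrivals and the schedule of one slot. *)
Definition outcome := ({ffun 'I_n * 'I_n -> 'I_N.+1} * 'M[bool]_n)%type.

Definition switch_weight (p : 'I_n * 'I_n -> 'I_N.+1 -> R) (x : 'M[nat]_n)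
    (o : outcome) : R :=
  (\prod_u p u (o.1 u)) * ((o.2 \in maxweight x)%:R / #|maxweight x|%:R).

Definition switch_step (x : 'M[nat]_n) (o : outcome) : 'M[nat]_n :=
  \matrix_(i, j) (x i j + o.1 (i, j) - o.2 i j)%N.

Lemma sum_maxweight (x : 'M[nat]_n) :
  \sum_(s : 'M[bool]_n) (s \in maxweight x)%:R = #|maxweight x|%:R :> R.
Proof.
rewrite -sum1_card natr_sum [RHS]big_mkcond.
by apply: eq_bigr => s _; case: (s \in _).
Qed.

Variable p : 'I_n * 'I_n -> 'I_N.+1 -> R.
Hypothesis p0 : forall u b, 0 <= p u b.
Hypothesis p1 : forall u, \sum_b p u b = 1.

Lemma switch_weight_ge0 x o : 0 <= switch_weight p x o.
Proof. by rewrite mulr_ge0 ?divr_ge0 // prodr_ge0. Qed.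

Lemma switch_weight_sum1 x : \sum_o switch_weight p x o = 1.
Proof.
rewrite -(pair_bigA _ (fun m s => switch_weight p x (m, s))) /= /switch_weight /=.
under eq_bigr do rewrite -mulr_sumr -mulr_suml.
rewrite -mulr_suml -bigA_distr_bigA /= big1 ?mul1r; last by move=> u _; exact: p1.
by rewrite sum_maxweight divff // pnatr_eq0 -lt0n; exact: maxweight_gt0.
Qed.

End Kernel.

(** * The one-step law of the switch and its stationary distribution *)

Section SwitchLaw.
Variables (d : measure_display) (T : measurableType d) (R : realType) (n : nat).
Variables (a q : nat -> T -> 'M[nat]_n) (s : nat -> T -> 'M[bool]_n).
Variables (P : probability T R) (amax : nat) (lambda sigma : 'M[R]_n).
Hypothesis H : maxweight_switch a q s P amax lambda sigma.

(** Slot 0 stands for every slot, as the arrivals are identically distributed. *)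
Definition arrival_pmf (u : 'I_n * 'I_n) (b : 'I_amax.+1) : R :=
  fine (P [set w | a 0%N w u.1 u.2 = b]).
Notation p := arrival_pmf.

Lemma measurable_arrival t i j m : measurable [set w | a t w i j = m].
Proof. exact: (arrival_rv H t [set x | x i j = m]). Qed.

Lemma arrival_pmfE t u (b : 'I_amax.+1) :
  P [set w | a t w u.1 u.2 = b] = (p u b)%:E.
Proof.
rewrite (arrival_identical H t 0) /arrival_pmf fineK //.
by rewrite fin_num_measure //; exact: measurable_arrival.
Qed.

Lemma arrival_pmf_ge0 u b : 0 <= p u b.
Proof. by rewrite fine_ge0. Qed.

Lemma arrival_expectation u (f : nat -> R) : (forall m, 0 <= f m) ->
  (\int[P]_w (f (a 0%N w u.1 u.2))%:E = (\sum_b p u b * f b)%:E)%E.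
Proof.
move=> f0; pose Z w : 'I_amax.+1 := inord (a 0%N w u.1 u.2).
have ZE w : (Z w : nat) = a 0%N w u.1 u.2.
  by rewrite inordK // ltnS (arrival_bounded H).
have Zpre o : Z @^-1` [set o] = [set w | a 0%N w u.1 u.2 = o].
  apply/seteqP; split=> w /=; first by move=> <-; rewrite ZE.
  by move=> h; apply: val_inj; rewrite /= ZE.
(* Conditioning on a constant turns [integral_kernel] into a plain expectation; the fibres over
   values other than 0 are empty. *)
have d0 : discrete_rv (fun _ : T => 0%N).
  move=> B; have [b0|b0] := pselect (B 0%N).
    by rewrite (_ : _ @^-1` _ = setT) //; apply/seteqP; split.
  by rewrite (_ : _ @^-1` _ = set0) //; apply/seteqP; split.
under eq_integral do rewrite -ZE.
rewrite (@integral_kernel _ _ _ P _ _ d0 _ Z (fun x o => if x == 0%N then p u o else 0)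
  (fun _ o => o) f) //=.
- by rewrite integral_probability_cst.
- by move=> o; rewrite Zpre; exact: measurable_arrival.
- by move=> v o; case: ifP => // _; exact: arrival_pmf_ge0.
- move=> x o; rewrite Zpre; case: eqP => [->|x0].
    rewrite (_ : _ @^-1` _ = setT); last by apply/seteqP; split.
    by rewrite setTI probability_setT mule1 arrival_pmfE.
  rewrite (_ : _ @^-1` _ = set0); last by apply/seteqP; split => // w /= e; rewrite e in x0.
  by rewrite set0I measure0 mule0.
Qed.

Lemma arrival_pmf_sum1 u : \sum_b p u b = 1.
Proof.
have := @arrival_expectation u (fun=> 1) (fun=> ler01).
rewrite integral_probability_cst => -[->].
by apply: eq_bigr => b _; rewrite mulr1.
Qed.

Lemma arrival_pmf_mean u : \sum_b p u b * (b : nat)%:R = lambda u.1 u.2.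
Proof.
have := arrival_mean H 0 u.1 u.2; rewrite unlock.
by rewrite (@arrival_expectation u (fun m => m%:R)) // => -[].
Qed.

Lemma arrival_pmf_variance u :
  \sum_b p u b * ((b : nat)%:R - lambda u.1 u.2) ^+ 2 = sigma u.1 u.2 ^+ 2.
Proof.
have := arrival_variance H 0 u.1 u.2; rewrite /variance unlock.
rewrite (arrival_mean H 0 u.1 u.2) /= unlock.
have := @arrival_expectation u (fun m => (m%:R - lambda u.1 u.2) ^+ 2).
move=> e1 e2; apply: EFin_inj; rewrite -e1 => [|m]; last exact: sqr_ge0.
by rewrite -e2; apply: eq_integral => w _; rewrite expr2.
Qed.

Lemma arrival_joint t (m : {ffun 'I_n * 'I_n -> 'I_amax.+1}) :
  P [set w | forall u, a t w u.1 u.2 = m u] = (\prod_u p u (m u))%:E.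
Proof.
pose g (u : 'I_n * 'I_n) : nat * 'I_n * 'I_n := (t, u.1, u.2).
have gI : injective g by move=> [i j] [i' j'] [-> ->].
(* Independence is applied to all the queues at the single slot [t]. *)
pose J := [fset x in [seq g u | u <- enum {: 'I_n * 'I_n}]]%fset.
have := arrival_independent H J (fun v => [set (m (v.1.2, v.2) : nat)]).
have -> : \bigcap_(i in [set` J]) (fun w => a i.1.1 w i.1.2 i.2) @^-1` [set (m (i.1.2, i.2) : nat)]
    = [set w | forall u, a t w u.1 u.2 = m u].
  apply/seteqP; split=> w /= h.
    move=> [i j]; apply: (h (t, i, j)); rewrite /= inE.
    by apply/mapP; exists (i, j); rewrite ?mem_enum.
  move=> v /=; rewrite inE => /mapP[[i j] _ ->] /=; exact: (h (i, j)).
move=> ->; rewrite (perm_big [seq g u | u <- enum {: 'I_n * 'I_n}]) /=; last first.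
  apply: uniq_perm; rewrite ?fset_uniq ?(map_inj_uniq gI) ?enum_uniq //.
  by move=> v; rewrite inE.
rewrite big_map big_enum /= -prodEFin; apply: eq_bigr => -[i j] _.
exact: (arrival_pmfE t (i, j)).
Qed.

(** Given the queue lengths, the arrivals and the schedule of the slot have the product law
    [switch_weight], so [integral_kernel] applies. *)
Lemma switch_transition t (f : 'M[nat]_n -> R) : (forall x, 0 <= f x) ->
  (\int[P]_w (f (q t.+1 w))%:E =
   \int[P]_w (average (switch_weight p) (@switch_step n amax) f (q t w))%:E)%E.
Proof.
move=> f0.
pose Z w : outcome n amax := ([ffun u => inord (a t w u.1 u.2)], s t w).
have ZE w u : ((Z w).1 u : nat) = a t w u.1 u.2.
  by rewrite ffunE inordK // ltnS (arrival_bounded H).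
have Zpre o : Z @^-1` [set o] =
    [set w | forall u, a t w u.1 u.2 = o.1 u] `&` s t @^-1` [set o.2].
  apply/seteqP; split=> w /=.
    by move=> <-; split => // u; rewrite ZE.
  case: o => m s0 /= [am ss]; congr pair => //.
  by apply/ffunP => u; apply: val_inj; rewrite /= -am -ZE.
have mA (m : {ffun 'I_n * 'I_n -> 'I_amax.+1}) :
    measurable [set w | forall u, a t w u.1 u.2 = m u].
  exact: (arrival_rv H t [set x : 'M[nat]_n | forall u : 'I_n * 'I_n, x u.1 u.2 = m u :> nat]).
under eq_integral => w _.
  rewrite (_ : q t.+1 w = switch_step (q t w) (Z w)); last first.
    by apply/matrixP => i j; rewrite mxE ZE (queue_update H).
  over.
apply: (integral_kernel (queue_rv H t) (Z := Z)) => //.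
- by move=> o; rewrite Zpre; apply: measurableI => //; exact: schedule_rv H t _.
- by move=> v o; apply: switch_weight_ge0 => u b; exact: arrival_pmf_ge0.
move=> x [m s0]; rewrite Zpre /= setICA.
(* The arrivals are first split off from the pair of queue and schedule; the schedule law, taken
   with the trivial event on the history, gives the other factor. *)
have := arrival_exogenous H (t := t) [set y : 'M[nat]_n | forall u : 'I_n * 'I_n, y u.1 u.2 = m u :> nat]
   [set h | h.1.2 = x /\ h.2 = s0].
have -> : (fun w => (history a q s t w, s t w)) @^-1` [set h | h.1.2 = x /\ h.2 = s0] =
  q t @^-1` [set x] `&` s t @^-1` [set s0] by [].
move=> ->; rewrite arrival_joint.
have := schedule_maxweight H (t := t) setT x s0; rewrite preimage_setT !setTI => ->.
by rewrite muleA EFinM.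
Qed.

Variables (d' : measure_display) (T' : measurableType d').
Variables (P' : probability T' R) (qbar : T' -> 'M[nat]_n).
Hypothesis q_cvg : cvg_in_distribution P q P' qbar.

(** The one-step identity passes to the limit: [f] and its average are both bounded, and a shifted
    sequence has the same limit. *)
Lemma switch_stationary :
  stationary P' qbar (switch_weight p) (@switch_step n amax).
Proof.
move=> f f0 [M fM].
have w0 := switch_weight_ge0 arrival_pmf_ge0.
have w1 := switch_weight_sum1 arrival_pmf_sum1.
have bf : exists M, forall v, `|f v| <= M by exists M => v; rewrite ger0_norm.
have bKf : exists M, forall v, `|average (switch_weight p) (@switch_step n amax) f v| <= M.
  exists M => v; rewrite ger0_norm; last by apply: (average_ge0 _ w0).
  by rewrite -(average_cst (@switch_step n amax) w1 M v); apply: (le_average w0) => o _.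
have c1 := q_cvg bf; have c2 := q_cvg bKf.
move: c1 c2; rewrite unlock -cvg_shiftS => c1 c2.
rewrite (eq_cvg _ _ (fun t => switch_transition t f0)) in c1.
by rewrite -(cvg_lim _ c1) // -(cvg_lim _ c2).
Qed.

End SwitchLaw.

(** * The inner product and the cone of maximal weights *)

Section Inner.
Variables (R : realType) (n : nat).
Implicit Types (x y z : 'M[R]_n) (w v : 'I_n -> R).

Lemma innerC x y : inner x y = inner y x.
Proof. by do 2!apply: eq_bigr => ? _; rewrite mulrC. Qed.

Lemma innerDr x y z : inner x (y + z) = inner x y + inner x z.
Proof.
rewrite /inner -big_split; apply: eq_bigr => i _; rewrite -big_split.
by apply: eq_bigr => j _; rewrite mxE mulrDr.
Qed.

Lemma innerZr c x y : inner x (c *: y) = c * inner x y.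
Proof.
rewrite /inner mulr_sumr; apply: eq_bigr => i _; rewrite mulr_sumr.
by apply: eq_bigr => j _; rewrite mxE mulrCA.
Qed.

Lemma innerNr x y : inner x (- y) = - inner x y.
Proof. by rewrite -scaleN1r innerZr mulN1r. Qed.

Lemma innerDl x y z : inner (x + y) z = inner x z + inner y z.
Proof. by rewrite innerC innerDr !(innerC z). Qed.

Lemma innerZl c x y : inner (c *: x) y = c * inner x y.
Proof. by rewrite innerC innerZr innerC. Qed.

Lemma innerNl x y : inner (- x) y = - inner x y.
Proof. by rewrite innerC innerNr innerC. Qed.

Definition inner_linear := (innerDl, innerDr, innerZl, innerZr, innerNl, innerNr).

Lemma inner_sqrD x y :
  inner (x + y) (x + y) = inner x x + 2 * inner x y + inner y y.
Proof. by rewrite !inner_linear (innerC y x); ring. Qed.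

Lemma inner_ge0 x y : (forall i j, 0 <= x i j) -> (forall i j, 0 <= y i j) ->
  0 <= inner x y.
Proof. by move=> x0 y0; do 2!apply: sumr_ge0 => ? _; rewrite mulr_ge0. Qed.

Lemma inner_sqr_ge0 x : 0 <= inner x x.
Proof. by do 2!apply: sumr_ge0 => ? _; rewrite -expr2 sqr_ge0. Qed.

Lemma norm2_sqr x : norm2 x ^+ 2 = inner x x.
Proof. by rewrite sqr_sqrtr // inner_sqr_ge0. Qed.

Lemma norm2_ge0 x : 0 <= norm2 x.
Proof. exact: sqrtr_ge0. Qed.

Lemma cauchy_schwarz x y : inner x y ^+ 2 <= inner x x * inner y y.
Proof.
have key c b : 0 <= b ^+ 2 * inner x x - 2 * b * c * inner x y + c ^+ 2 * inner y y.
  have := inner_sqr_ge0 (b *: x - c *: y); rewrite !inner_linear (innerC y x).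
  by move=> h; apply: etrans h; congr (0 <= _); ring.
(* If [<y, y> = 0], the chosen coefficients turn the form into [- (<x, x> + 2) <x, y>^2], which
   forces [<x, y> = 0]. *)
have := inner_sqr_ge0 y; rewrite le_eqVlt => /orP[/eqP y0|y0].
  have := key (inner x x + 1) (inner x y); rewrite -y0.
  have := inner_sqr_ge0 x; have := sqr_ge0 (inner x y); nra.
have := key (inner x y) (inner y y).
have -> : inner y y ^+ 2 * inner x x - 2 * inner y y * inner x y * inner x y +
   inner x y ^+ 2 * inner y y = inner y y * (inner x x * inner y y - inner x y ^+ 2).
  by ring.
by rewrite pmulr_rge0 // subr_ge0.
Qed.

Lemma norm2_cauchy x y : `|inner x y| <= norm2 x * norm2 y.
Proof.
rewrite -ler_sqr ?nnegrE ?mulr_ge0 ?norm2_ge0 //.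
by rewrite real_normK ?num_real // exprMn !norm2_sqr cauchy_schwarz.
Qed.

Lemma norm2_le_sum x : (forall i j, 0 <= x i j) ->
  norm2 x <= \sum_i \sum_j x i j.
Proof.
move=> x0; have S0 : 0 <= \sum_i \sum_j x i j by do 2!apply: sumr_ge0 => ? _.
rewrite -ler_sqr ?nnegrE ?norm2_ge0 // norm2_sqr expr2.
rewrite [leRHS]mulr_suml; apply: ler_sum => i _.
rewrite [leRHS]mulr_suml; apply: ler_sum => j _; rewrite ler_wpM2l //.
rewrite (bigD1 i) //= (bigD1 j) //= -addrA lerDl addr_ge0 //.
  by apply: sumr_ge0.
by do 2!apply: sumr_ge0 => ? _.
Qed.

Definition rowsum x i : R := \sum_j x i j.
Definition colsum x j : R := \sum_i x i j.

Definition psum w v : 'M[R]_n := \matrix_(i, j) (w i + v j).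

Lemma inner_psum w v x :
  inner (psum w v) x = \sum_i w i * rowsum x i + \sum_j v j * colsum x j.
Proof.
rewrite /inner; under eq_bigr do under eq_bigr do rewrite mxE mulrDl.
under eq_bigr do rewrite big_split.
rewrite big_split /=; congr (_ + _); last rewrite exchange_big /=;
  by apply: eq_bigr => i _; rewrite mulr_sumr.
Qed.

(** In particular the matrices [psum w v] are orthogonal to the difference of two doubly stochastic
    matrices. *)
Lemma eq_inner_psum w v x y :
  (forall i, rowsum x i = rowsum y i) -> (forall j, colsum x j = colsum y j) ->
  inner (psum w v) x = inner (psum w v) y.
Proof.
move=> rxy cxy; rewrite !inner_psum.
by congr (_ + _); apply: eq_bigr => i _; rewrite ?rxy ?cxy.
Qed.

Lemma inner_row_ones x i : inner x (row_ones R i) = rowsum x i.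
Proof.
rewrite /inner (bigD1 i) //= [X in _ + X]big1 ?addr0 => [|k ki].
  by apply: eq_bigr => j _; rewrite mxE eqxx mulr1.
by rewrite big1 // => j _; rewrite mxE (negPf ki) mulr0.
Qed.

Lemma inner_col_ones x j : inner x (col_ones R j) = colsum x j.
Proof.
apply: eq_bigr => i _; rewrite (bigD1 j) //= mxE eqxx mulr1 big1 ?addr0 // => k kj.
by rewrite mxE (negPf kj) mulr0.
Qed.

Lemma inner_ones x : inner x (const_mx 1) = \sum_i rowsum x i.
Proof. by do 2!apply: eq_bigr => ? _; rewrite mxE mulr1. Qed.

Lemma sum_colsum x : \sum_j colsum x j = \sum_i rowsum x i.
Proof. exact: exchange_big. Qed.

(* The orthogonal projection onto the span of the matrices [psum w v]. *)
Definition lproj x : 'M[R]_n :=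
  psum (fun i => rowsum x i / n%:R - (\sum_k rowsum x k) / n%:R ^+ 2)
       (fun j => colsum x j / n%:R).

Hypothesis n0 : (0 < n)%N.

Lemma natn_neq0 : n%:R != 0 :> R.
Proof. by rewrite pnatr_eq0 -lt0n. Qed.

Lemma rowsum_proj x i : rowsum (lproj x) i = rowsum x i.
Proof.
rewrite {1}/rowsum; under eq_bigr do rewrite mxE.
rewrite big_split /= sumr_const card_ord -mulr_suml sum_colsum -mulr_natl.
by have := natn_neq0; move: (rowsum x i) (\sum_k _) => a b h; field.
Qed.

Lemma colsum_proj x j : colsum (lproj x) j = colsum x j.
Proof.
rewrite {1}/colsum; under eq_bigr do rewrite mxE.
rewrite big_split /= big_split /= !sumr_const card_ord -mulr_suml.
rewrite -[X in _ + X + _]mulr_natl -[X in _ + _ + X]mulr_natl.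
by have := natn_neq0; move: (colsum x j) (\sum_k _) => a b h; field.
Qed.

(** [lproj] preserves row and column sums, so [x - lproj x] is orthogonal to the span. Symmetry and
    idempotence in the inner product follow, as [lproj x] is itself a [psum]. *)
Lemma inner_psum_proj w v x : inner (psum w v) (lproj x) = inner (psum w v) x.
Proof. by apply: eq_inner_psum => ?; rewrite ?rowsum_proj ?colsum_proj. Qed.

Lemma inner_projC x y : inner (lproj x) y = inner x (lproj y).
Proof. by rewrite -inner_psum_proj innerC inner_psum_proj innerC. Qed.

Lemma inner_proj_proj x y : inner (lproj x) (lproj y) = inner x (lproj y).
Proof. by rewrite [LHS]inner_psum_proj inner_projC. Qed.

Lemma inner_proj_ge0 x : 0 <= inner x (lproj x).
Proof. by rewrite -inner_proj_proj inner_sqr_ge0. Qed.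

Lemma inner_proj_le x : inner x (lproj x) <= inner x x.
Proof.
have := inner_sqr_ge0 (x - lproj x).
rewrite !inner_linear inner_proj_proj (inner_projC x x); lra.
Qed.

(** This formula is the source of the factor [2 / n - 1 / n^2] in front of the variance. *)
Lemma inner_projE x : inner x (lproj x) =
  (\sum_i rowsum x i ^+ 2 + \sum_j colsum x j ^+ 2) / n%:R
  - (\sum_i rowsum x i) ^+ 2 / n%:R ^+ 2.
Proof.
have e1 t : \sum_i (rowsum x i / n%:R - t) * rowsum x i =
    (\sum_i rowsum x i ^+ 2) / n%:R - t * \sum_i rowsum x i.
  by rewrite mulr_suml mulr_sumr -sumrB; apply: eq_bigr => i _; ring.
have e2 : \sum_j colsum x j / n%:R * colsum x j = (\sum_j colsum x j ^+ 2) / n%:R.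
  by rewrite mulr_suml; apply: eq_bigr => j _; ring.
by rewrite innerC inner_psum e1 e2; ring.
Qed.

Lemma projD x y : lproj (x + y) = lproj x + lproj y.
Proof.
have rD i : rowsum (x + y) i = rowsum x i + rowsum y i.
  by rewrite -big_split; apply: eq_bigr => j _; rewrite mxE.
have cD j : colsum (x + y) j = colsum x j + colsum y j.
  by rewrite -big_split; apply: eq_bigr => i _; rewrite mxE.
apply/matrixP => i j; rewrite !mxE rD cD; under eq_bigr do rewrite rD.
by rewrite big_split /=; ring.
Qed.

Lemma projZ c x : lproj (c *: x) = c *: lproj x.
Proof.
have rZ i : rowsum (c *: x) i = c * rowsum x i.
  by rewrite mulr_sumr; apply: eq_bigr => j _; rewrite mxE.
have cZ j : colsum (c *: x) j = c * colsum x j.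
  by rewrite mulr_sumr; apply: eq_bigr => i _; rewrite mxE.
apply/matrixP => i j; rewrite !mxE rZ cZ; under eq_bigr do rewrite rZ.
by rewrite -mulr_sumr; ring.
Qed.

Lemma projN x : lproj (- x) = - lproj x.
Proof. by rewrite -scaleN1r projZ scaleN1r. Qed.

Lemma inner_young c x y : 0 < c ->
  `|2 * inner x y| <= c * inner x x + c^-1 * inner y y.
Proof.
move=> c0; have h b : 0 <= c * inner x x + 2 * b * inner x y + b ^+ 2 * (c^-1 * inner y y).
  have := mulr_ge0 (ltW c0) (inner_sqr_ge0 (x + (b / c) *: y)).
  rewrite inner_sqrD innerZr innerZr innerZl => h; apply: etrans h; congr (0 <= _).
  by field; rewrite gt_eqF.
by rewrite ler_norml; have := h 1; have := h (-1); rewrite sqrrN expr1n; lra.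
Qed.

Lemma eq_proj x y : (forall i, rowsum x i = rowsum y i) ->
  (forall j, colsum x j = colsum y j) -> lproj x = lproj y.
Proof.
move=> rxy cxy; apply/matrixP => i j; rewrite !mxE rxy cxy.
by under eq_bigr do rewrite rxy.
Qed.

End Inner.

(** * Moments of the transitions *)

Section ArrivalMoments.
Variables (R : realType) (n N : nat).
Variable p : 'I_n * 'I_n -> 'I_N.+1 -> R.
Hypothesis p1 : forall u, \sum_b p u b = 1.
Variables lambda sigma : 'M[R]_n.
Hypothesis pmean : forall u, \sum_b p u b * (b : nat)%:R = lambda u.1 u.2.
Hypothesis pvar : forall u,
  \sum_b p u b * ((b : nat)%:R - lambda u.1 u.2) ^+ 2 = sigma u.1 u.2 ^+ 2.

Definition arrivals (o : outcome n N) : 'M[R]_n :=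
  \matrix_(i, j) (o.1 (i, j) : nat)%:R.

Lemma mean_arrivals x (g : {ffun 'I_n * 'I_n -> 'I_N.+1} -> R) :
  \sum_o switch_weight p x o * g o.1 = \sum_(m : {ffun 'I_n * 'I_n -> 'I_N.+1}) (\prod_u p u (m u)) * g m.
Proof.
rewrite -(pair_bigA _ (fun m s => switch_weight p x (m, s) * g m)) /=.
apply: eq_bigr => m _; rewrite -mulr_suml; congr (_ * _).
rewrite /switch_weight /= -mulr_sumr -mulr_suml.
by rewrite sum_maxweight divff ?mulr1 // pnatr_eq0 -lt0n; exact: maxweight_gt0.
Qed.

Lemma mean_prod (g : 'I_n * 'I_n -> 'I_N.+1 -> R) :
  \sum_(m : {ffun 'I_n * 'I_n -> 'I_N.+1}) (\prod_u p u (m u)) * \prod_u g u (m u) =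
  \prod_u \sum_b p u b * g u b.
Proof.
by rewrite bigA_distr_bigA; apply: eq_bigr => m _; rewrite big_split.
Qed.

Definition deviation (u : 'I_n * 'I_n) (b : 'I_N.+1) : R :=
  (b : nat)%:R - lambda u.1 u.2.

Lemma sum_deviation u : \sum_b p u b * deviation u b = 0.
Proof.
under eq_bigr do rewrite mulrBr.
by rewrite sumrB pmean -mulr_suml p1 mul1r subrr.
Qed.

Lemma mean_deviation u :
  \sum_(m : {ffun 'I_n * 'I_n -> 'I_N.+1}) (\prod_u p u (m u)) * deviation u (m u) = 0.
Proof.
transitivity (\prod_v \sum_b p v b * (if v == u then deviation v b else 1)).
  rewrite -mean_prod; apply: eq_bigr => m _; congr (_ * _).
  by rewrite -big_mkcond big_pred1_eq.
by rewrite (bigD1 u) //= eqxx sum_deviation mul0r.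
Qed.

(** By independence the mean of a product over the queues factorises, with factor 1 at the queues
    not involved; for [u != v] a centred factor vanishes. *)
Lemma mean_deviation2 u v :
  \sum_(m : {ffun 'I_n * 'I_n -> 'I_N.+1})
     (\prod_u p u (m u)) * (deviation u (m u) * deviation v (m v)) =
  (u == v)%:R * sigma u.1 u.2 ^+ 2.
Proof.
transitivity (\prod_k \sum_b p k b * ((if k == u then deviation k b else 1) *
                                      (if k == v then deviation k b else 1))).
  rewrite -mean_prod; apply: eq_bigr => m _; congr (_ * _).
  by rewrite big_split /= -!big_mkcond !big_pred1_eq.
rewrite (bigD1 u) //= eqxx; case: eqVneq => [<-|uv].
  rewrite mul1r; under eq_bigr do rewrite -expr2.
  rewrite pvar big1 ?mulr1 // => k /negPf ->.
  by under eq_bigr do rewrite mul1r mulr1.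
by under eq_bigr do rewrite mulr1; rewrite sum_deviation !mul0r.
Qed.

Lemma inner_pair (x y : 'M[R]_n) : inner x y = \sum_u x u.1 u.2 * y u.1 u.2.
Proof. by rewrite /inner pair_bigA. Qed.

Lemma inner_deviation c (o : outcome n N) : inner c (arrivals o - lambda) =
  \sum_u c u.1 u.2 * deviation u (o.1 u).
Proof. by rewrite inner_pair; apply: eq_bigr => -[i j] _; rewrite !mxE. Qed.

Lemma mean_inner c x :
  \sum_o switch_weight p x o * inner c (arrivals o - lambda) = 0.
Proof.
under eq_bigr do rewrite inner_deviation.
rewrite (mean_arrivals x (fun m => \sum_u c u.1 u.2 * deviation u (m u))).
under eq_bigr do rewrite mulr_sumr.
rewrite exchange_big big1 //= => u _.
under eq_bigr do rewrite mulrCA.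
by rewrite -mulr_sumr mean_deviation mulr0.
Qed.

Lemma mean_inner_sqr c x :
  \sum_o switch_weight p x o * inner c (arrivals o - lambda) ^+ 2 =
  \sum_u c u.1 u.2 ^+ 2 * sigma u.1 u.2 ^+ 2.
Proof.
under eq_bigr do rewrite inner_deviation.
rewrite (mean_arrivals x (fun m => (\sum_u c u.1 u.2 * deviation u (m u)) ^+ 2)).
transitivity (\sum_(m : {ffun 'I_n * 'I_n -> 'I_N.+1}) \sum_u \sum_v (c u.1 u.2 * c v.1 v.2) *
    ((\prod_u p u (m u)) * (deviation u (m u) * deviation v (m v)))).
  apply: eq_bigr => m _; rewrite expr2 mulr_suml mulr_sumr; apply: eq_bigr => u _.
  by rewrite mulr_sumr mulr_sumr; apply: eq_bigr => v _; ring.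
rewrite exchange_big; apply: eq_bigr => u _ /=.
rewrite exchange_big (bigD1 u) //= -mulr_sumr mean_deviation2 eqxx mul1r -expr2.
rewrite big1 ?addr0 // => v vu.
by rewrite -mulr_sumr mean_deviation2 eq_sym (negPf vu) mul0r mulr0.
Qed.

(** The variances of all row sums add up to [|sigma|^2], and so do those of all column sums; the
    total sum has variance [|sigma|^2] too. These enter [inner_projE] with factors [1 / n], [1 / n]
    and [- 1 / n^2]. *)
Lemma mean_inner_proj x : (0 < n)%N ->
  \sum_o switch_weight p x o *
    inner (arrivals o - lambda) (lproj (arrivals o - lambda)) =
  (2 / n%:R - n%:R ^- 2) * inner sigma sigma.
Proof.
move=> n0; have nn0 := natn_neq0 R n0.
transitivity (\sum_o ((\sum_i switch_weight p x o * inner (row_ones R i) (arrivals o - lambda) ^+ 2 +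
   \sum_j switch_weight p x o * inner (col_ones R j) (arrivals o - lambda) ^+ 2) / n%:R -
   switch_weight p x o * inner (const_mx 1) (arrivals o - lambda) ^+ 2 / n%:R ^+ 2)).
  apply: eq_bigr => o _; set z := arrivals o - lambda.
  rewrite inner_projE -!mulr_sumr (innerC (const_mx 1)) inner_ones.
  have -> : \sum_i rowsum z i ^+ 2 = \sum_i inner (row_ones R i) z ^+ 2.
    by apply: eq_bigr => i _; rewrite innerC inner_row_ones.
  have -> : \sum_j colsum z j ^+ 2 = \sum_j inner (col_ones R j) z ^+ 2.
    by apply: eq_bigr => j _; rewrite innerC inner_col_ones.
  by rewrite mulrBr !mulrA mulrDr.
rewrite sumrB -!mulr_suml big_split /= exchange_big.
under eq_bigr do rewrite mean_inner_sqr.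
rewrite [X in (_ + X) / _]exchange_big /=.
under [X in (_ + X) / _]eq_bigr do rewrite mean_inner_sqr.
rewrite mean_inner_sqr.
have -> : \sum_i \sum_u (row_ones R i) u.1 u.2 ^+ 2 * sigma u.1 u.2 ^+ 2 = inner sigma sigma.
  rewrite exchange_big inner_pair; apply: eq_bigr => u _ /=.
  rewrite (bigD1 u.1) //= mxE eqxx expr1n mul1r big1 ?addr0 // => k ku.
  by rewrite mxE eq_sym (negPf ku) expr0n mul0r.
have -> : \sum_i \sum_u (col_ones R i) u.1 u.2 ^+ 2 * sigma u.1 u.2 ^+ 2 = inner sigma sigma.
  rewrite exchange_big inner_pair; apply: eq_bigr => u _ /=.
  rewrite (bigD1 u.2) //= mxE eqxx expr1n mul1r big1 ?addr0 // => k ku.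
  by rewrite mxE eq_sym (negPf ku) expr0n mul0r.
have -> : \sum_(u : 'I_n * 'I_n) (const_mx 1 : 'M[R]_n) u.1 u.2 ^+ 2 * sigma u.1 u.2 ^+ 2 = inner sigma sigma.
  by rewrite inner_pair; apply: eq_bigr => u _; rewrite mxE expr1n mul1r.
by field.
Qed.

End ArrivalMoments.

Section Step.
Variables (R : realType) (n N : nat).
Implicit Types (x : 'M[nat]_n) (o : outcome n N).

Definition service o : 'M[R]_n := \matrix_(i, j) (o.2 i j)%:R.

Definition idle x o : 'M[R]_n :=
  \matrix_(i, j) (x i j + o.1 (i, j) < o.2 i j)%N%:R.

Definition increment x o : 'M[R]_n := arrivals R o - service o + idle x o.

Lemma natmx_step x o :
  natmx R (switch_step x o) = natmx R x + increment x o.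
Proof.
apply/matrixP => i j; rewrite !mxE; case: ltnP => h /=.
  have -> : (x i j + o.1 (i, j) - o.2 i j = 0)%N by lia.
  have -> : (o.2 i j : nat) = (x i j + o.1 (i, j) + 1)%N by case: (o.2 i j) h => /=; lia.
  by rewrite !natrD; ring.
by rewrite natrB // natrD; ring.
Qed.

(** A service is wasted only on a queue that ends the slot empty. *)
Lemma inner_idle_step x o : inner (natmx R (switch_step x o)) (idle x o) = 0.
Proof.
rewrite /inner big1 // => i _; rewrite big1 // => j _; rewrite !mxE.
case: ltnP => h; last by rewrite mulr0.
by rewrite (_ : _ - _ = 0)%N ?mul0r //; lia.
Qed.

Lemma inner_idle x o : inner (natmx R x) (idle x o) = 0.
Proof.
rewrite /inner big1 // => i _; rewrite big1 // => j _; rewrite !mxE.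
case: ltnP => h; last by rewrite mulr0.
by rewrite (_ : x i j = 0)%N ?mul0r //; case: (o.2 i j) h => /=; lia.
Qed.

Lemma idle_ge0 x o i j : 0 <= idle x o i j.
Proof. by rewrite mxE. Qed.

Lemma inner_idle_idle x o : inner (idle x o) (idle x o) = \sum_i rowsum (idle x o) i.
Proof.
do 2!apply: eq_bigr => ? _; rewrite mxE.
by case: ltnP => _; rewrite ?mulr1 ?mulr0.
Qed.

Lemma inner_increment_le x o :
  inner (increment x o) (increment x o) <= (n * n * N.+1 ^ 2)%:R.
Proof.
have le1 i j : increment x o i j ^+ 2 <= (N.+1 ^ 2)%:R.
  have -> : increment x o i j = (switch_step x o i j)%:R - (x i j)%:R.
    have := congr1 (fun M : 'M[R]_n => M i j) (natmx_step x o).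
    by rewrite /= !mxE => ->; ring.
  rewrite natrX -[leLHS]real_normK ?num_real // ler_sqr ?nnegrE //.
  have hN : (o.1 (i, j) <= N)%N by rewrite -ltnS.
  have h1 : (switch_step x o i j <= x i j + N.+1)%N by rewrite mxE; lia.
  have h2 : (x i j <= switch_step x o i j + N.+1)%N.
    by rewrite mxE; case: (o.2 i j) => /=; lia.
  rewrite ler_norml; move: h1 h2; rewrite -!(ler_nat R) !natrD => h1 h2.
  by apply/andP; split; lra.
apply: (@le_trans _ _ (\sum_(i < n) \sum_(j < n) (N.+1 ^ 2)%:R)).
  by do 2!apply: ler_sum => ? _; rewrite -expr2.
rewrite !sumr_const !card_ord -!mulrnA ler_nat.
by rewrite [leqRHS]mulnC ?mulnA.
Qed.

Lemma maxweight_of_weight (p : 'I_n * 'I_n -> 'I_N.+1 -> R) x o :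
  0 < switch_weight p x o -> o.2 \in maxweight x.
Proof.
by rewrite /switch_weight; case: (o.2 \in _) => //=; rewrite mul0r mulr0 ltxx.
Qed.

Lemma rowsum_service x o i : o.2 \in maxweight x -> rowsum (service o) i = 1.
Proof.
rewrite inE => /andP[/andP[_ /forallP h] _]; rewrite /rowsum.
under eq_bigr do rewrite mxE.
by rewrite -natr_sum (eqP (h i)).
Qed.

Lemma colsum_service x o j : o.2 \in maxweight x -> colsum (service o) j = 1.
Proof.
rewrite inE => /andP[/andP[/forallP h _] _]; rewrite /colsum.
under eq_bigr do rewrite mxE.
by rewrite -natr_sum (eqP (h j)).
Qed.

End Step.

(** * Drift of the MaxWeight switch *)

Section CoverDistance.
Variables (R : realType) (n : nat).
Implicit Type x : 'M[nat]_n.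

(** Only the integral points of the cone: the dual solutions are integral, and a nearest such point
    exists without compactness. *)
Definition cover (c : ('I_n -> nat) * ('I_n -> nat)) : 'M[R]_n :=
  psum (fun i => (c.1 i)%:R) (fun j => (c.2 j)%:R).

(** For a dual optimal cover the weight of the schedule is the sum of all cover weights, which is
    [<cover c, nu>] because [nu] has unit row and column sums. *)
Lemma maxweight_cover_real N x (o : outcome n N) (nu : 'M[R]_n) :
  (forall i, rowsum nu i = 1) -> (forall j, colsum nu j = 1) ->
  o.2 \in maxweight x ->
  exists c, (forall i j, 0 <= (cover c - natmx R x) i j) /\
    inner (natmx R x) (nu - service R o) = - inner (cover c - natmx R x) nu.
Proof.
move=> nur nuc os; have [w [v [cov wE]]] := maxweight_cover os.
exists (w, v); split=> [i j|].
  by rewrite !mxE subr_ge0 -natrD ler_nat.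
rewrite !inner_linear opprB; congr (_ - _).
rewrite inner_psum; under eq_bigr do rewrite nur mulr1.
under [X in _ = _ + X]eq_bigr do rewrite nuc mulr1.
rewrite -!natr_sum -natrD -wE /weight natr_sum; apply: eq_bigr => i _.
by rewrite natr_sum; apply: eq_bigr => j _; rewrite !mxE natrM.
Qed.

Lemma cover_dist_nat x c : exists m : nat,
  inner (natmx R x - cover c) (natmx R x - cover c) = m%:R.
Proof.
exists (\sum_i \sum_j ((x i j - (c.1 i + c.2 j)) + ((c.1 i + c.2 j) - x i j)) ^ 2)%N.
rewrite natr_sum; apply: eq_bigr => i _; rewrite natr_sum; apply: eq_bigr => j _.
rewrite !mxE -natrD natrX; have [h|h] := leqP (x i j) (c.1 i + c.2 j).
  have /eqP -> : (x i j - (c.1 i + c.2 j) == 0)%N by rewrite subn_eq0.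
  by rewrite add0n natrB //; ring.
have /eqP -> : ((c.1 i + c.2 j) - x i j == 0)%N by rewrite subn_eq0 ltnW.
by rewrite addn0 natrB 1?ltnW //; ring.
Qed.

(** The squared distances are natural numbers, so a least one is attained. *)
Lemma closest_cover : exists pt : 'M[nat]_n -> ('I_n -> nat) * ('I_n -> nat),
  forall x c, inner (natmx R x - cover (pt x)) (natmx R x - cover (pt x)) <=
              inner (natmx R x - cover c) (natmx R x - cover c).
Proof.
suff ex x : exists c0, forall c,
    inner (natmx R x - cover c0) (natmx R x - cover c0) <=
    inner (natmx R x - cover c) (natmx R x - cover c).
  by have [pt ptP] := choice ex; exists pt.
pose Q m := `[< exists c, inner (natmx R x - cover c) (natmx R x - cover c) = m%:R >].
have exQ : exists m, Q m.
  have [m mE] := cover_dist_nat x (fun=> 0%N, fun=> 0%N).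
  by exists m; apply/asboolP; eexists; exact: mE.
case: (ex_minnP exQ) => m /asboolP[c0 c0E] mmin; exists c0 => c.
have [m' m'E] := cover_dist_nat x c.
by rewrite c0E m'E ler_nat mmin //; apply/asboolP; exists c.
Qed.

End CoverDistance.

(** * Lyapunov bounds for the MaxWeight switch *)

Section SwitchDrift.
Variables (d : measure_display) (T : measurableType d) (R : realType).
Variables (P : probability T R) (n N : nat) (X : T -> 'M[nat]_n).
Hypothesis dX : discrete_rv X.
Hypothesis n0 : (0 < n)%N.
Variable p : 'I_n * 'I_n -> 'I_N.+1 -> R.
Hypothesis p0 : forall u b, 0 <= p u b.
Hypothesis p1 : forall u, \sum_b p u b = 1.
Hypothesis stat : stationary P X (switch_weight p) (@switch_step n N).
Variables lambda sigma : 'M[R]_n.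
Hypothesis pmean : forall u, \sum_b p u b * (b : nat)%:R = lambda u.1 u.2.
Hypothesis pvar : forall u,
  \sum_b p u b * ((b : nat)%:R - lambda u.1 u.2) ^+ 2 = sigma u.1 u.2 ^+ 2.
Notation K := (average (switch_weight p) (@switch_step n N)).
Notation w0 := (switch_weight_ge0 p0).
Notation w1 := (switch_weight_sum1 p1).
Implicit Type x : 'M[nat]_n.

Definition jump_bound : R := (n * n * N.+1 ^ 2)%:R.

(** Used twice: with [pt = 0] for the norm of the queue vector, and with the nearest cover for the
    distance to the cone. *)
Lemma switch_moment (c : R) (pt : 'M[nat]_n -> 'M[R]_n) :
  let D x := inner (natmx R x - pt x) (natmx R x - pt x) in
  0 < c -> (forall x i j, 0 <= pt x i j) ->
  (forall x y, D y <= inner (natmx R y - pt x) (natmx R y - pt x)) ->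
  (forall x (o : outcome n N), o.2 \in maxweight x ->
     inner (natmx R x - pt x) (lambda - service R o) <=
     - (c * norm2 (natmx R x - pt x))) ->
  (\int[P]_t (D (X t))%:E <= (moment_constant c jump_bound)%:E)%E.
Proof.
move=> D c0 pt0 near drift.
apply: (lyapunov_moment dX w0 w1 stat
  (ip := fun x o => inner (natmx R x - pt x) (increment R x o))) => //.
- by move=> x; exact: inner_sqr_ge0.
- move=> x o _; apply: (le_trans (near x _)); rewrite natmx_step addrAC.
  rewrite inner_sqrD; have := inner_increment_le R x o; rewrite -/jump_bound /D; lra.
- move=> x o _; rewrite mulrC; apply: le_trans (cauchy_schwarz _ _) _.
  by rewrite ler_wpM2l ?inner_sqr_ge0 // inner_increment_le.
move=> x; set z := natmx R x - pt x.
apply: (@le_trans _ _ (\sum_o switch_weight p x o *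
   (inner z (arrivals R o - lambda) - c * norm2 z))).
  apply: ler_sum => o _; have := w0 x o.
  rewrite le_eqVlt => /orP[/eqP <-|wpos]; first by rewrite !mul0r.
  rewrite ler_pM2l //; have := drift x o (maxweight_of_weight wpos).
  have : inner z (idle R x o) <= 0.
    rewrite /z !inner_linear inner_idle sub0r oppr_le0.
    by apply: inner_ge0 => // i j; exact: idle_ge0.
  rewrite /increment -/z !innerDr !innerNr; lra.
under eq_bigr do rewrite mulrBr.
by rewrite sumrB mean_inner // -mulr_suml w1 mul1r sub0r.
Qed.

Variables (nu k : 'M[R]_n) (e : R).
Hypothesis nu_row : forall i, rowsum nu i = 1.
Hypothesis nu_col : forall j, colsum nu j = 1.
Hypothesis k_sum : \sum_i rowsum k i = n%:R.
Hypothesis e0 : 0 < e.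
Hypothesis lambdaE : lambda = nu - e *: k.
Hypothesis lambda0 : forall i j, 0 <= lambda i j.

(** The rate matrix lies below a doubly stochastic matrix [nu'] by a positive margin in every entry,
    so the queue norm has negative drift. The margin shrinks with [e], hence only finiteness is
    kept. *)
Lemma second_moment_fin :
  (forall i, 0 < rowsum k i) -> (forall j, 0 < colsum k j) ->
  (\int[P]_t (inner (natmx R (X t)) (natmx R (X t)))%:E < +oo)%E.
Proof.
move=> kr kc.
(* The row and column sums of [M] are [n] times those of [k], so [(e / n) M] restores exactly the
   capacity removed by [e k]. *)
pose M : 'M[R]_n := \matrix_(i, j) (rowsum k i * colsum k j).
have [m m0 mM] : exists2 m : R, 0 < m & forall i j, m <= M i j.
  exists (\big[Num.min/1]_(u : 'I_n * 'I_n) M u.1 u.2).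
    by apply: lt_bigmin => // u _; rewrite mxE mulr_gt0.
  by move=> i j; apply: (bigmin_le_cond _ (j := (i, j))).
have nn0 : n%:R != 0 :> R := natn_neq0 R n0.
have n0R : 0 < n%:R :> R by rewrite ltr0n.
pose nu' := lambda + (e / n%:R) *: M.
have nu'E i j : nu' i j = nu i j - e * k i j + e / n%:R * (rowsum k i * colsum k j).
  by rewrite /nu' lambdaE !mxE.
have nu'r i : rowsum nu' i = 1.
  rewrite /rowsum; under eq_bigr do rewrite nu'E.
  rewrite big_split /= sumrB -!mulr_sumr -/(rowsum nu i) -/(rowsum k i).
  by rewrite nu_row sum_colsum k_sum; field.
have nu'c j : colsum nu' j = 1.
  rewrite /colsum; under eq_bigr do rewrite nu'E.
  rewrite big_split /= sumrB -!mulr_sumr -mulr_suml -/(colsum nu j) -/(colsum k j).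
  by rewrite nu_col k_sum; field.
have en0 : 0 < e / n%:R by rewrite divr_gt0.
have c0 : 0 < e / n%:R * m by rewrite mulr_gt0.
have := @switch_moment (e / n%:R * m) (fun=> 0) c0 _ _ _.
rewrite /=; under eq_integral do rewrite subr0.
move=> h; apply: le_lt_trans (h _ _ _) (ltry _).
- by move=> x i j; rewrite mxE.
- by move=> x y; rewrite !subr0.
move=> x o os; rewrite subr0.
have [c [c0' cE]] := maxweight_cover_real nu'r nu'c os.
have -> : lambda - service R o = (nu' - service R o) - (e / n%:R) *: M.
  by rewrite /nu' addrAC addrK.
have X0 i j : 0 <= natmx R x i j by rewrite mxE.
rewrite innerDr cE innerNr innerZr.
have h1 : 0 <= inner (cover R c - natmx R x) nu'.
  apply: inner_ge0 => // i j; rewrite mxE addr_ge0 // mxE mulr_ge0 ?(ltW en0) //.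
  exact: le_trans (ltW m0) (mM i j).
have h2 : m * norm2 (natmx R x) <= inner (natmx R x) M.
  apply: (le_trans (ler_wpM2l (ltW m0) (norm2_le_sum X0))).
  rewrite mulr_sumr; apply: ler_sum => i _; rewrite mulr_sumr; apply: ler_sum => j _.
  by rewrite mulrC ler_wpM2l.
have h3 := ler_wpM2l (ltW en0) h2; rewrite mulrA in h3; lra.
Qed.

(** * State space collapse onto the cone *)

Variable pt : 'M[nat]_n -> ('I_n -> nat) * ('I_n -> nat).
Hypothesis ptP : forall x c,
  inner (natmx R x - cover R (pt x)) (natmx R x - cover R (pt x)) <=
  inner (natmx R x - cover R c) (natmx R x - cover R c).

Definition collapse_dist x : R :=
  inner (natmx R x - cover R (pt x)) (natmx R x - cover R (pt x)).

Lemma collapse_moment (num : R) :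
  0 < num -> (forall i j, num <= nu i j) -> e * norm2 k <= num / 2 ->
  (\int[P]_t (collapse_dist (X t))%:E <=
   (moment_constant (num / 2) jump_bound)%:E)%E.
Proof.
move=> num0 numle ek.
apply: (@switch_moment (num / 2) (fun x => cover R (pt x))).
- by rewrite divr_gt0.
- by move=> x i j; rewrite mxE addr_ge0.
- by move=> x y; exact: ptP.
move=> x o os; set z := natmx R x - _.
have [c [c0' cE]] := maxweight_cover_real nu_row nu_col os.
have -> : lambda - service R o = (nu - service R o) - e *: k by rewrite lambdaE addrAC.
(* The nearest cover is orthogonal to [nu - service R o], so it drops out and the duality identity
   remains. *)
have zE : inner z (nu - service R o) = - inner (cover R c - natmx R x) nu.
  rewrite /z innerDl cE innerNl innerDr innerNr.
  rewrite (@eq_inner_psum _ _ _ _ nu (service R o)) ?subrr ?subr0 // => ?.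
    by rewrite nu_row (rowsum_service _ _ os).
  by rewrite nu_col (colsum_service _ _ os).
rewrite innerDr zE innerNr innerZr.
(* The dual cover [c] is no nearer to [x] than [pt x], and its entrywise surplus over [x] is
   weighted by entries of [nu] that are at least [num]. *)
have h1 : num * norm2 z <= inner (cover R c - natmx R x) nu.
  have h : norm2 z <= norm2 (cover R c - natmx R x).
    rewrite -ler_sqr ?nnegrE ?norm2_ge0 // !norm2_sqr.
    by apply: (le_trans (ptP x c)); rewrite -opprB innerNl innerNr opprK.
  apply: (le_trans (ler_wpM2l (ltW num0) (le_trans h (norm2_le_sum c0')))).
  rewrite mulr_sumr; apply: ler_sum => i _; rewrite mulr_sumr; apply: ler_sum => j _.
  by rewrite mulrC ler_wpM2l.
have h2 : - inner z k <= norm2 z * norm2 k.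
  by apply: le_trans (norm2_cauchy z k); rewrite -normrN ler_norm.
have h3 := ler_wpM2l (ltW e0) h2; have h4 := ler_wpM2l (norm2_ge0 z) ek.
nra.
Qed.

(** * Drift of the projected energy *)

Variable alpha : 'M[R]_n.
Hypothesis alpha_row : forall i, rowsum alpha i = n%:R * rowsum k i.
Hypothesis alpha_col : forall j, colsum alpha j = n%:R * colsum k j.

Definition energy x : R := inner (natmx R x) (lproj (natmx R x)).
Definition total x : R := inner (natmx R x) (const_mx 1).
Definition limit_energy : R :=
  (2 / n%:R - n%:R ^- 2) * inner sigma sigma + e ^+ 2 * inner k (lproj k).
Definition weight_gap : R := inner (lproj alpha - alpha) (lproj alpha - alpha).

Lemma total_idle x (o : outcome n N) : o.2 \in maxweight x ->
  inner (idle R x o) (idle R x o) =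
  total (switch_step x o) - total x - inner (const_mx 1) (arrivals R o - lambda) + e * n%:R.
Proof.
move=> os; rewrite inner_idle_idle -inner_ones /total natmx_step.
have l1 : inner lambda (const_mx 1) = n%:R - e * n%:R.
  rewrite lambdaE innerDl innerNl innerZl !inner_ones k_sum.
  by under eq_bigr do rewrite nu_row; rewrite sumr_const card_ord.
have s1 : inner (service R o) (const_mx 1) = n%:R.
  rewrite inner_ones; under eq_bigr do rewrite (rowsum_service _ _ os).
  by rewrite sumr_const card_ord.
rewrite /increment (innerC (const_mx 1)) !inner_linear l1 s1; ring.
Qed.

Lemma step_energy x (o : outcome n N) c : o.2 \in maxweight x -> 0 < c ->
  `|energy (switch_step x o) - (energy x + 2 * inner (lproj (natmx R x)) (arrivals R o - lambda)
     - 2 * e * inner (natmx R x) (lproj k) + inner (arrivals R o - lambda) (lproj (arrivals R o - lambda))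
     - 2 * e * inner (lproj k) (arrivals R o - lambda) + e ^+ 2 * inner k (lproj k))| <=
  c * collapse_dist (switch_step x o) + (c^-1 + 1) * inner (idle R x o) (idle R x o).
Proof.
move=> os c0; set z := arrivals R o - lambda; set Y := natmx R (switch_step x o); set U := idle R x o.
have sym (a b : 'M[R]_n) : inner b (lproj a) = inner a (lproj b).
  by rewrite innerC inner_projC.
have YU : Y - U = natmx R x + z + (lambda - service R o).
  by rewrite /Y natmx_step /increment /z /U; apply/matrixP => i j; rewrite !mxE; ring.
(* [nu - service R o] has zero row and column sums, so its projection vanishes. *)
clearbody z; have Pls : lproj (lambda - service R o) = - e *: lproj k.
  rewrite -projZ; apply: eq_proj => i.
    rewrite -!inner_row_ones lambdaE !inner_linear !inner_row_ones nu_row.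
    by rewrite (rowsum_service _ _ os); ring.
  rewrite -!inner_col_ones lambdaE !inner_linear !inner_col_ones nu_col.
  by rewrite (colsum_service _ _ os); ring.
have e1 : inner (Y - U) (lproj (Y - U)) = energy x + 2 * inner (lproj (natmx R x)) z
     - 2 * e * inner (natmx R x) (lproj k) + inner z (lproj z)
     - 2 * e * inner (lproj k) z + e ^+ 2 * inner k (lproj k).
  rewrite -inner_proj_proj // YU projD Pls projD !inner_linear !inner_proj_proj //.
  rewrite !(inner_projC n0) /energy (sym (natmx R x) z) (sym (natmx R x) k) (sym z k).
  by ring.
(* As [<Y, U> = 0] and covers are orthogonal to [lproj U - U], the large vector [Y] may be replaced
   by its deviation from the nearest cover. *)
have e2 : energy (switch_step x o) - inner (Y - U) (lproj (Y - U)) =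
    2 * inner (Y - cover R (pt (switch_step x o))) (lproj U - U) - inner U (lproj U).
  rewrite /energy -/Y projD projN !inner_linear (inner_psum_proj n0).
  by rewrite (sym Y U) (inner_idle_step R x o); ring.
rewrite -e1 e2.
have h1 := inner_young (Y - cover R (pt (switch_step x o))) (lproj U - U) c0.
have h2 : inner (lproj U - U) (lproj U - U) = inner U U - inner U (lproj U).
  by rewrite !inner_linear (inner_proj_proj n0) (inner_projC n0); ring.
have h3 := inner_proj_ge0 n0 U; have h4 := inner_proj_le n0 U.
apply: (le_trans (ler_normB _ _)); rewrite (ger0_norm h3).
apply: (le_trans (lerD h1 (lexx _))); rewrite h2 -/(collapse_dist _).
have : 0 <= c^-1 * inner U (lproj U) by rewrite mulr_ge0 // invr_ge0 ltW.
rewrite /collapse_dist -/Y; lra.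
Qed.

Definition mean x (g : outcome n N -> R) : R := \sum_o switch_weight p x o * g o.

Lemma meanD x g h : mean x (fun o => g o + h o) = mean x g + mean x h.
Proof. by rewrite /mean -big_split; apply: eq_bigr => o _; rewrite mulrDr. Qed.

Lemma meanZ x c g : mean x (fun o => c * g o) = c * mean x g.
Proof. by rewrite /mean mulr_sumr; apply: eq_bigr => o _; rewrite mulrCA. Qed.

Lemma mean_cst x c : mean x (fun=> c) = c.
Proof. by rewrite /mean -mulr_suml w1 mul1r. Qed.

Lemma energy_drift x c : 0 < c ->
  `|K energy x - energy x + 2 * e * inner (natmx R x) (lproj k) - limit_energy| <=
  c * K collapse_dist x + (c^-1 + 1) * (K total x - total x + e * n%:R).
Proof.
move=> c0; pose z (o : outcome n N) : 'M[R]_n := arrivals R o - lambda.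
pose G o := energy x + 2 * inner (lproj (natmx R x)) (z o)
     + - (2 * e * inner (natmx R x) (lproj k)) + inner (z o) (lproj (z o))
     + (- (2 * e)) * inner (lproj k) (z o) + e ^+ 2 * inner k (lproj k).
have -> : K energy x - energy x + 2 * e * inner (natmx R x) (lproj k) - limit_energy
    = mean x (fun o => energy (switch_step x o) + (-1) * G o).
  rewrite meanD meanZ !meanD !meanZ !mean_cst.
  rewrite [mean x (fun o => inner _ (z o))]mean_inner //.
  rewrite [mean x (fun o => inner (lproj k) (z o))]mean_inner //.
  rewrite [mean x (fun o => inner (z o) (lproj (z o)))](mean_inner_proj p1 pmean pvar) //.
  by rewrite /limit_energy /average /mean; ring.
have -> : c * K collapse_dist x + (c^-1 + 1) * (K total x - total x + e * n%:R) =
    mean x (fun o => c * collapse_dist (switch_step x o) + (c^-1 + 1) *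
      (total (switch_step x o) + - total x + (-1) * inner (const_mx 1) (z o) + e * n%:R)).
  rewrite meanD !meanZ !meanD !meanZ !mean_cst.
  rewrite [mean x (fun o => inner (const_mx 1) (z o))]mean_inner //.
  by rewrite /average /mean; ring.
apply: (le_trans (ler_norm_sum _ _ _)); apply: ler_sum => o _.
have := w0 x o; rewrite le_eqVlt => /orP[/eqP <-|wpos]; first by rewrite !mul0r normr0.
rewrite normrM gtr0_norm // ler_pM2l //.
have os := maxweight_of_weight wpos.
have h := step_energy os c0; rewrite (total_idle os) -/(z o) in h.
by rewrite /G [-1 * inner (const_mx 1) _]mulN1r mulN1r mulNr; exact: h.
Qed.

Lemma weight_drift x c : 0 < c ->
  `|2 * e / n%:R * inner (natmx R x) alpha - limit_energy + (K energy x - energy x)| <=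
  e / n%:R * weight_gap + e / n%:R * collapse_dist x +
  (c * K collapse_dist x + (c^-1 + 1) * (K total x - total x + e * n%:R)).
Proof.
move=> c0; have nn0 := natn_neq0 R n0.
have en0 : 0 < e / n%:R by rewrite divr_gt0 // ltr0n.
have Pa : lproj alpha = n%:R *: lproj k.
  rewrite -projZ; apply: eq_proj => i.
    by rewrite alpha_row -[RHS]inner_row_ones innerZl inner_row_ones.
  by rewrite alpha_col -[RHS]inner_col_ones innerZl inner_col_ones.
(* [alpha] and its projection agree on covers, so replacing one by the other costs only the
   deviation of [x] from the cone. *)
have split : inner (natmx R x) (lproj alpha) = inner (natmx R x) alpha +
    inner (natmx R x - cover R (pt x)) (lproj alpha - alpha).
  by rewrite !inner_linear (inner_psum_proj n0); ring.
have kE : 2 * e * inner (natmx R x) (lproj k) =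
    2 * e / n%:R * inner (natmx R x) alpha +
    e / n%:R * (2 * inner (natmx R x - cover R (pt x)) (lproj alpha - alpha)).
  have -> : inner (natmx R x) (lproj k) = inner (natmx R x) (lproj alpha) / n%:R.
    by rewrite Pa innerZr; field.
  by rewrite split; field.
have := energy_drift x c0; rewrite kE => h1.
have h2 := inner_young (natmx R x - cover R (pt x)) (lproj alpha - alpha) ltr01.
rewrite -/(collapse_dist x) -/weight_gap invr1 !mul1r in h2.
have := ler_wpM2l (ltW en0) h2.
move: h1; move: (2 * inner (natmx R x - _) _) => y h1 h3.
have h4 : `|e / n%:R * y| <= e / n%:R * (collapse_dist x + weight_gap).
  by rewrite normrM (gtr0_norm en0).
move: h1 h4; rewrite !ler_norml => /andP[h1 h1'] /andP[h4 h4'].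
by apply/andP; split; lra.
Qed.

Lemma natmx_inner_ge0 x (y : 'M[R]_n) : (forall i j, 0 <= y i j) ->
  0 <= inner (natmx R x) y.
Proof. by move=> y0; apply: inner_ge0 => // i j; rewrite mxE. Qed.

Lemma total_ge0 x : 0 <= total x.
Proof. by apply: natmx_inner_ge0 => i j; rewrite mxE. Qed.

Lemma total_le x : total x <= inner (natmx R x) (natmx R x).
Proof.
do 2!apply: ler_sum => ? _; rewrite !mxE mulr1 -natrM ler_nat.
by case: (x _ _) => // m; rewrite mulnS leq_addr.
Qed.

Lemma collapse_dist_le x : collapse_dist x <= inner (natmx R x) (natmx R x).
Proof.
apply: (le_trans (ptP x (fun=> 0%N, fun=> 0%N))).
rewrite (_ : cover _ _ = 0) ?subr0 //.
by apply/matrixP => i j; rewrite !mxE addr0.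
Qed.

Lemma integral_quadratic_fin (F : 'M[nat]_n -> R) (M : R) :
  (\int[P]_t (inner (natmx R (X t)) (natmx R (X t)))%:E < +oo)%E ->
  (forall x, 0 <= F x) -> 0 <= M ->
  (forall x, F x <= M * (inner (natmx R x) (natmx R x) + 1)) ->
  (\int[P]_t (F (X t))%:E < +oo)%E.
Proof.
move=> sqfin F0 M0 FM; pose sq x : R := inner (natmx R x) (natmx R x).
have sq0 x : 0 <= sq x by exact: inner_sqr_ge0.
apply: (@le_lt_trans _ _ (\int[P]_t (M%:E * ((sq (X t))%:E + 1%:E)))%E).
  apply: ge0_le_integral => //.
  - by move=> t _; rewrite lee_fin.
  - exact: (measurable_discrete_rv F dX).
  - exact: (measurable_discrete_rv (fun x => M * (sq x + 1)) dX).
  - by move=> t _; rewrite -EFinD -EFinM lee_fin.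
rewrite ge0_integralZl_EFin //; last 2 first.
- by move=> t _; rewrite lee_fin addr_ge0.
- exact: (measurable_discrete_rv (fun x => sq x + 1)).
rewrite ge0_integralD //; last 2 first.
- by move=> t _; rewrite lee_fin.
- exact: (measurable_discrete_rv sq).
rewrite integral_probability_cst lte_mul_pinfty ?lee_fin //.
by rewrite lte_add_pinfty // ltry.
Qed.

(** Both sides of [weight_drift] are integrated; finite second moments make all energy and
    total-length differences average to zero. *)
Lemma mean_weight (c C : R) : 0 < c ->
  (\int[P]_t (inner (natmx R (X t)) (natmx R (X t)))%:E < +oo)%E ->
  (\int[P]_t (collapse_dist (X t))%:E <= C%:E)%E ->
  P.-integrable setT (EFin \o (fun t => inner (natmx R (X t)) alpha)) /\
  `|2 * e / n%:R * (\int[P]_t inner (natmx R (X t)) alpha)%R - limit_energy| <=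
  e / n%:R * weight_gap + (c^-1 + 1) * (e * n%:R) + (e / n%:R + c) * C.
Proof.
move=> c0 sqfin DC; set a := 2 * e / n%:R.
have mT : measurable [set: T] by [].
have en0 : 0 < e / n%:R by rewrite divr_gt0 // ltr0n.
have C0 : 0 <= c^-1 + 1 by rewrite addr_ge0 // invr_ge0 ltW.
have sq0 x : 0 <= inner (natmx R x) (natmx R x) by exact: inner_sqr_ge0.
have ia : P.-integrable setT (EFin \o (fun t => inner (natmx R (X t)) alpha)).
  apply: (@integrable_discrete_rv _ _ _ _ _ _ dX (fun x => inner (natmx R x) alpha)
    (fun x => inner (natmx R x) (natmx R x) + inner alpha alpha)).
    move=> x; have := inner_young (natmx R x) alpha ltr01.
    rewrite invr1 !mul1r normrM gtr0_norm // => h.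
    have := normr_ge0 (inner (natmx R x) alpha); lra.
  have aa := inner_sqr_ge0 alpha.
  apply: (@integral_quadratic_fin (fun x => inner (natmx R x) (natmx R x) + inner alpha alpha)
    (1 + inner alpha alpha) sqfin) => [x||x].
  - by rewrite addr_ge0.
  - by rewrite addr_ge0.
  - by have := mulr_ge0 aa (sq0 x); rewrite mulrDr mulr1 mulrDl mul1r; lra.
split=> //.
have iza : P.-integrable setT (EFin \o (fun t => a * inner (natmx R (X t)) alpha)).
  by have := integrableZl mT a ia.
have ic : P.-integrable setT (EFin \o (fun _ : T => limit_energy)).
  exact: finite_measure_integrable_cst.
(* Writing [c K D = c D + c (K D - D)] leaves a multiple of [D] plus the differences of [F1]. The
   energy difference joins [F1] for the lower bound and stands apart with the opposite sign for the
   upper bound. *)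
pose F1 x := c * collapse_dist x + (c^-1 + 1) * total x.
pose F2 x := c * collapse_dist x + (c^-1 + 1) * total x + energy x.
have D0 x : 0 <= collapse_dist x by exact: inner_sqr_ge0.
have E0 x : 0 <= energy x by exact: inner_proj_ge0.
have F10 x : 0 <= F1 x by rewrite addr_ge0 ?mulr_ge0 ?total_ge0 // ltW.
have F20 x : 0 <= F2 x by rewrite addr_ge0 // F10.
have F1le x : F1 x <= (c + (c^-1 + 1)) * inner (natmx R x) (natmx R x).
  rewrite mulrDl; apply: lerD; apply: ler_wpM2l => //.
  - exact: ltW.
  - exact: collapse_dist_le.
  - exact: total_le.
have Ele x : energy x <= inner (natmx R x) (natmx R x) by exact: inner_proj_le.
have CC0 : 0 <= c + (c^-1 + 1) by rewrite addr_ge0 // ltW.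
have F1fin : (\int[P]_t (F1 (X t))%:E < +oo)%E.
  apply: (@integral_quadratic_fin F1 (c + (c^-1 + 1)) sqfin) => // x.
  by rewrite mulrDr mulr1; have := F1le x; lra.
have F2fin : (\int[P]_t (F2 (X t))%:E < +oo)%E.
  apply: (@integral_quadratic_fin F2 (c + (c^-1 + 1) + 1) sqfin) => // [|x].
    by rewrite addr_ge0.
  rewrite mulrDr mulr1 [in leRHS]mulrDl mul1r /F2 -/(F1 x).
  by have := F1le x; have := Ele x; lra.
have Efin : (\int[P]_t (energy (X t))%:E < +oo)%E.
  apply: (@integral_quadratic_fin energy 1 sqfin) => // x.
  by rewrite mul1r; have := Ele x; lra.
have c10 : 0 <= e / n%:R + c by rewrite addr_ge0 // ltW.
have KF1 x : K F1 x = c * K collapse_dist x + (c^-1 + 1) * K total x.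
  by rewrite averageD !averageZ.
have KF2 x : K F2 x = K F1 x + K energy x by rewrite /F2 averageD.
rewrite ler_norml; apply/andP; split.
  rewrite lerNl opprB.
  have -> : limit_energy - a * (\int[P]_t inner (natmx R (X t)) alpha)%R =
      (\int[P]_t (limit_energy - a * inner (natmx R (X t)) alpha))%R.
    by rewrite RintegralB // RintegralZl // /Rintegral integral_probability_cst.
  apply: (@stationary_mean_le _ _ _ P _ X dX _ _ _ w0 stat
    (fun x => limit_energy - a * inner (natmx R x) alpha) collapse_dist F2 (fun=> 0)
    (e / n%:R * weight_gap + (c^-1 + 1) * (e * n%:R)) (e / n%:R + c)) => //.
  - by rewrite integral0.
  - exact: (integrableB mT ic iza).
  move=> x; rewrite (average_cst _ w1) KF2 KF1 /F2.
  by have := weight_drift x c0; rewrite -/a ler_norml => /andP[h _]; lra.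
have -> : a * (\int[P]_t inner (natmx R (X t)) alpha)%R - limit_energy =
    (\int[P]_t (a * inner (natmx R (X t)) alpha - limit_energy))%R.
  by rewrite RintegralB // RintegralZl // /Rintegral integral_probability_cst.
apply: (@stationary_mean_le _ _ _ P _ X dX _ _ _ w0 stat
  (fun x => a * inner (natmx R x) alpha - limit_energy) collapse_dist F1 energy
  (e / n%:R * weight_gap + (c^-1 + 1) * (e * n%:R)) (e / n%:R + c)) => //.
- exact: (integrableB mT iza ic).
move=> x; rewrite KF1 /F1.
by have := weight_drift x c0; rewrite -/a ler_norml => /andP[_ h]; lra.
Qed.

End SwitchDrift.

(** * The saturated regime *)

Section Saturation.
Variables (R : realType) (n : nat).
Hypothesis n0 : (0 < n)%N.
Implicit Types (x nu k : 'M[R]_n).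

Lemma min_entry_le x i j : min_entry x <= x i j.
Proof.
apply: ge_inf; last by exists (i, j).
exists (- \sum_i \sum_j `|x i j|) => _ [[i' j'] _ <-] /=.
apply: (@le_trans _ _ (- `|x i' j'|)); last by have := ler_norm (- x i' j'); rewrite normrN; lra.
rewrite lerN2 (bigD1 i') //= (bigD1 j') //= -addrA lerDl addr_ge0 //.
  by apply: sumr_ge0.
by do 2!apply: sumr_ge0 => ? _.
Qed.

Lemma norm_entry_le x i j : `|x i j| <= norm2 x.
Proof.
rewrite -ler_sqr ?nnegrE ?norm2_ge0 // norm2_sqr real_normK ?num_real //.
rewrite /inner (bigD1 i) //= (bigD1 j) //= -addrA -expr2 lerDl addr_ge0 //.
  by apply: sumr_ge0 => j' _; rewrite -expr2 sqr_ge0.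
by do 2!apply: sumr_ge0 => ? _; rewrite -expr2 sqr_ge0.
Qed.

(** Cauchy-Schwarz against the all-ones matrix, whose norm is [n]. *)
Lemma norm2_ge1 k : inner k (const_mx 1) = n%:R -> 1 <= norm2 k.
Proof.
move=> kn; have := cauchy_schwarz k (const_mx 1); rewrite kn.
have -> : inner (const_mx 1 : 'M[R]_n) (const_mx 1) = n%:R ^+ 2.
  rewrite inner_ones /rowsum; under eq_bigr do under eq_bigr do rewrite mxE.
  by rewrite !sumr_const !card_ord -mulrnA natrM expr2.
rewrite -norm2_sqr ler_pMl; last by rewrite exprn_gt0 // ltr0n.
by move=> h; rewrite -ler_sqr ?nnegrE ?norm2_ge0 // expr1n.
Qed.

Lemma saturated_admissible nu k e :
  (forall i, \sum_(j < n) nu i j = 1) -> 0 < min_entry nu ->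
  inner k (const_mx 1) = n%:R -> 0 < e <= min_entry nu / (2 * norm2 k) ->
  admissible nu k e /\ e * norm2 k <= min_entry nu / 2.
Proof.
move=> nur m0 kn /andP[e0 ele]; have k1 := norm2_ge1 kn.
have k0 : 0 < norm2 k by apply: lt_le_trans k1.
have ek : e * norm2 k <= min_entry nu / 2.
  move: ele; rewrite ler_pdivlMr ?mulr_gt0 // => h.
  by rewrite ler_pdivlMr // -mulrA (mulrC (norm2 k)).
split=> //; split=> [|i j].
  rewrite e0 /=.
  (* A row of nonnegative entries sums to 1. With [norm2 k >= 1] this gives [e <= 1 / 2]. *)
  have m1 : min_entry nu <= 1.
    rewrite -(nur (Ordinal n0)) (bigD1 (Ordinal n0)) //=.
    rewrite -[leLHS]addr0 lerD ?min_entry_le // sumr_ge0 // => j _.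
    exact: le_trans (ltW m0) (min_entry_le _ _ _).
  by have := ler_wpM2l (ltW e0) k1; lra.
rewrite !mxE; have h1 := min_entry_le nu i j.
have h2 : e * k i j <= e * norm2 k.
  by rewrite ler_wpM2l // ?(ltW e0) // (le_trans (ler_norm _)) // norm_entry_le.
lra.
Qed.

End Saturation.

(** Multiplication by [n / (2 e)] turns [2 / n - 1 / n^2] into [1 - 1 / (2 n)] and errors of order
    [sqrt e] into errors of order [1 / sqrt e]. *)
Lemma rescale_bound (R : realType) (n : nat) (e m S g A C : R) :
  (0 < n)%N -> 0 < e -> e < 1 -> 0 <= g -> 0 <= A -> 0 <= C ->
  `|2 * e / n%:R * m - ((2 / n%:R - n%:R ^- 2) * S + e ^+ 2 * A)| <=
    e / n%:R * g + ((Num.sqrt e)^-1 + 1) * (e * n%:R) + (e / n%:R + Num.sqrt e) * C ->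
  `|m - (1 - (2 * n%:R)^-1) * (S / e)| <=
    (g + n%:R ^+ 2 + (1 + n%:R) * C + n%:R * A) / Num.sqrt e.
Proof.
move=> n0 e0 e1 g0 A0 C0; set r := Num.sqrt e.
have r0 : 0 < r by rewrite sqrtr_gt0.
have er : e = r ^+ 2 by rewrite sqr_sqrtr // ltW.
have r1 : r < 1 by rewrite -(@ltr_pXn2r _ 2) ?nnegrE ?ltW // -er expr1n.
have N0 : 0 < n%:R :> R by rewrite ltr0n.
set N : R := n%:R in N0 *.
rewrite er => h.
have c0 : 0 < N / (2 * r ^+ 2) by rewrite divr_gt0 ?mulr_gt0 ?exprn_gt0.
have {h} := ler_wpM2l (ltW c0) h.
rewrite -{1}(gtr0_norm c0) -normrM.
have -> : N / (2 * r ^+ 2) * (2 * r ^+ 2 / N * m - ((2 / N - N ^- 2) * S + (r ^+ 2) ^+ 2 * A)) =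
  (m - (1 - (2 * N)^-1) * (S / r ^+ 2)) - N * r ^+ 2 * A / 2.
  by field; rewrite !gt_eqF.
have -> : N / (2 * r ^+ 2) * (r ^+ 2 / N * g + (r^-1 + 1) * (r ^+ 2 * N) + (r ^+ 2 / N + r) * C) =
  (r * g / 2 + (1 + r) * N ^+ 2 / 2 + (r + N) * C / 2) / r.
  by field; rewrite !gt_eqF.
set x := m - _ => h.
have hA : 0 <= N * r ^+ 2 * A / 2 by rewrite divr_ge0 // !mulr_ge0 // ?sqr_ge0 // ltW.
apply: (@le_trans _ _ ((r * g / 2 + (1 + r) * N ^+ 2 / 2 + (r + N) * C / 2) / r + N * r ^+ 2 * A / 2)).
  by move: h; rewrite !ler_norml => /andP[h h']; apply/andP; split; lra.
rewrite -[N * r ^+ 2 * A / 2](mulfK (lt0r_neq0 r0)) -mulrDl ler_pM2r ?invr_gt0 //.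
have NN : 0 <= N ^+ 2 by rewrite sqr_ge0.
have a1 : r * g <= g by rewrite ler_piMl // ltW.
have a2 : r * N ^+ 2 <= N ^+ 2 by rewrite ler_piMl // ltW.
have a3 : r * C <= C by rewrite ler_piMl // ltW.
have NA : 0 <= N * A by rewrite mulr_ge0 // ltW.
have a4 : r ^+ 3 * (N * A) <= N * A by rewrite ler_piMl // exprn_ile1 // ltW.
have NC : 0 <= N * C by rewrite mulr_ge0 // ltW.
have -> : N * r ^+ 2 * A / 2 * r = r ^+ 3 * (N * A) / 2 by ring.
have -> : (1 + r) * N ^+ 2 / 2 = N ^+ 2 / 2 + r * N ^+ 2 / 2 by ring.
have -> : (r + N) * C / 2 = r * C / 2 + N * C / 2 by ring.
have -> : (1 + N) * C = C + N * C by ring.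
lra.
Qed.

Lemma cvg_sumr (R : realType) (U : Type) (F : set_system U) (FF : Filter F)
    (I : Type) (r : seq I) (f : I -> U -> R) (l : I -> R) :
  (forall i, f i u @[u --> F] --> l i) ->
  \sum_(i <- r) f i u @[u --> F] --> \sum_(i <- r) l i.
Proof.
move=> fl; elim: r => [|i r IH].
  by rewrite big_nil; under eq_fun do rewrite big_nil; exact: cvg_cst.
rewrite big_cons; under eq_fun do rewrite big_cons.
exact: cvgD.
Qed.

(** * Heavy-traffic bounds and limit *)

Theorem corollary5 (R : realType) (n : nat) (n_gt0 : (0 < n)%N)
  (nu k : 'M[R]_n)
  (nu_row : forall i, \sum_(j < n) nu i j = 1)
  (nu_col : forall j, \sum_(i < n) nu i j = 1)
  (nu_min_gt0 : 0 < min_entry nu)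
  (k_ge0 : forall i j, 0 <= k i j)
  (k_ones : inner k (const_mx 1) = n%:R)
  (kappa_gt0 : forall i, 0 < inner k (row_ones R i))
  (kappat_gt0 : forall j, 0 < inner k (col_ones R j))
  (amax : nat)
  (* the switches, with their arrivals, schedules and queue lengths *)
  (d : measure_display) (T : R -> measurableType d)
  (P : forall e : R, probability (T e) R)
  (a : forall e : R, nat -> T e -> 'M[nat]_n)
  (s : forall e : R, nat -> T e -> 'M[bool]_n)
  (q : forall e : R, nat -> T e -> 'M[nat]_n)
  (sigma : R -> 'M[R]_n)
  (switchP : forall e : R, admissible nu k e ->
     maxweight_switch (a e) (q e) (s e) (P e) amax (nu - e *: k) (sigma e))
  (tsigma : R)
  (sigma_bounded : forall e : R, admissible nu k e ->
     norm2 (sigma e) ^+ 2 <= tsigma ^+ 2)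
  (* the steady-state queue lengths *)
  (d' : measure_display) (T' : R -> measurableType d')
  (P' : forall e : R, probability (T' e) R)
  (qbar : forall e : R, T' e -> 'M[nat]_n)
  (qbar_rv : forall e : R, admissible nu k e -> discrete_rv (qbar e))
  (q_cvg : forall e : R, admissible nu k e ->
     cvg_in_distribution (P e) (q e) (P' e) (qbar e))
  (alpha : 'M[R]_n)
  (alpha_row : forall i,
     inner alpha (row_ones R i) = n%:R * inner k (row_ones R i))
  (alpha_col : forall j,
     inner alpha (col_ones R j) = n%:R * inner k (col_ones R j)) :
  (exists B3 B4 : R -> R,
     [/\ B3 =o_ (0^'+) (fun e => e^-1),
         B4 =o_ (0^'+) (fun e => e^-1) &
         forall e : R, 0 < e <= min_entry nu / (2 * norm2 k) ->
         (((1 - (2 * n%:R)^-1) * (norm2 (sigma e) ^+ 2 / e) - B3 e)%:E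
            <= 'E_(P' e)[fun w => inner (natmx R (qbar e w)) alpha]
            <= ((1 - (2 * n%:R)^-1) * (norm2 (sigma e) ^+ 2 / e)
                + B4 e)%:E)%E]) /\
  (forall sigma0 : 'M[R]_n,
     (forall i j,
        (sigma e i j ^+ 2) @[e --> 0^'+] --> (sigma0 i j ^+ 2)) ->
     (e%:E * 'E_(P' e)[fun w => inner (natmx R (qbar e w)) alpha])%E
       @[e --> 0^'+]
     --> ((1 - (2 * n%:R)^-1) * norm2 sigma0 ^+ 2)%:E).
Proof.
have nuR i : rowsum nu i = 1 by exact: nu_row.
have nuC j : colsum nu j = 1 by exact: nu_col.
have kR i : 0 < rowsum k i by rewrite -inner_row_ones.
have kC j : 0 < colsum k j by rewrite -inner_col_ones.
have ksum : \sum_i rowsum k i = n%:R by rewrite -inner_ones.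
have aR i : rowsum alpha i = n%:R * rowsum k i by rewrite -!inner_row_ones.
have aC j : colsum alpha j = n%:R * colsum k j by rewrite -!inner_col_ones.
have n0R : 0 < n%:R :> R by rewrite ltr0n.
(* Neither [C], the bound on the mean squared distance to the cone, nor [W] depends on [e]. *)
pose C := moment_constant (min_entry nu / 2) (jump_bound R n amax).
pose W := weight_gap alpha + n%:R ^+ 2 + (1 + n%:R) * C + n%:R * inner k (lproj k).
pose m e := fine ('E_(P' e)[fun w => inner (natmx R (qbar e w)) alpha])%E.
have C0 : 0 <= C.
  have B0 : 0 <= jump_bound R n amax by rewrite /jump_bound.
  rewrite /C /moment_constant addr_ge0 // mulr_ge0 ?sqr_ge0 //.
  by rewrite addr_ge0 // mulr_ge0.
have g0 : 0 <= weight_gap alpha by exact: inner_sqr_ge0.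
have A0 : 0 <= inner k (lproj k) by exact: inner_proj_ge0.
have W0 : 0 <= W.
  by rewrite /W !addr_ge0 ?sqr_ge0 // mulr_ge0 // ?addr_ge0 // ltW.
have main e : 0 < e <= min_entry nu / (2 * norm2 k) ->
    ('E_(P' e)[fun w => inner (natmx R (qbar e w)) alpha])%E = (m e)%:E /\
    `|m e - (1 - (2 * n%:R)^-1) * (norm2 (sigma e) ^+ 2 / e)| <= W / Num.sqrt e.
  move=> he; have [adm ek] := saturated_admissible n_gt0 nu_row nu_min_gt0 k_ones he.
  have [/andP[e0 e1] lam0] := adm.
  have H := switchP e adm; have dq := qbar_rv e adm.
  have p0 := @arrival_pmf_ge0 _ _ _ _ (a e) (P e) amax.
  have p1 := arrival_pmf_sum1 H.
  have stat := switch_stationary H (q_cvg e adm).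
  have pm := arrival_pmf_mean H; have pv := arrival_pmf_variance H.
  have [pt ptP] := closest_cover R n.
  have sqfin := second_moment_fin dq n_gt0 p0 p1 stat pm nuR nuC ksum e0 erefl lam0 kR kC.
  have coll := collapse_moment dq p0 p1 stat pm nuR nuC e0 erefl ptP nu_min_gt0
    (min_entry_le nu) ek.
  (* [Num.sqrt e] is the Young parameter: it gives the errors [c * C] and [c^-1 * (e * n)] the same
     order. *)
  have r0 : 0 < Num.sqrt e by rewrite sqrtr_gt0.
  have [ia bound] := mean_weight dq n_gt0 p0 p1 stat pm pv nuR nuC ksum e0 erefl ptP
    aR aC r0 sqfin coll.
  have mE : ('E_(P' e)[fun w => inner (natmx R (qbar e w)) alpha])%E = (m e)%:E.
    by rewrite /m fineK // unlock; exact: integrable_fin_num.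
  split=> //; rewrite norm2_sqr; apply: rescale_bound => //.
  by move: bound; rewrite /limit_energy /m unlock.
pose B e : R := W / Num.sqrt e.
have e0 : 0 < min_entry nu / (2 * norm2 k).
  by rewrite divr_gt0 // mulr_gt0 // (lt_le_trans ltr01) // norm2_ge1.
have nearE : \forall e \near 0^'+, 0 < e <= min_entry nu / (2 * norm2 k).
  near=> e; apply/andP; split; first by near: e; exact: nbhs_right_gt.
  by near: e; exact: nbhs_right_le.
have sqrt0 : (Num.sqrt e @[e --> (0 : R)^'+] --> (0 : R)).
  rewrite -[X in _ --> X]sqrtr0; apply: cvg_at_right_filter; exact: sqrt_continuous.
have Bo : B =o_ (0^'+) (fun e => e^-1).
  apply/eqoP => eps eps0; near=> e.
  have e_gt0 : 0 < e by near: e; exact: nbhs_right_gt.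
  have r0 : 0 < Num.sqrt e by rewrite sqrtr_gt0.
  (* The threshold yields [Num.sqrt e * (W + 1) <= eps]; the denominator [W + 1] is positive even if
     [W = 0]. *)
  have eW : e < (eps / (W + 1)) ^+ 2.
    by near: e; apply: nbhs_right_lt; rewrite exprn_gt0 // divr_gt0 // ltr_wpDl.
  have rW : Num.sqrt e * (W + 1) <= eps.
    rewrite -ler_pdivlMr ?ltr_wpDl // -ler_sqr ?nnegrE ?(ltW r0) //; last first.
      by rewrite divr_ge0 ?(ltW eps0) // addr_ge0.
    by rewrite sqr_sqrtr ltW.
  rewrite ger0_norm; last by rewrite divr_ge0 // ltW.
  rewrite gtr0_norm ?invr_gt0 // ler_pdivrMr // -[e^-1](mulr1) -{1}(sqr_sqrtr (ltW e_gt0)).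
  have -> : eps * ((Num.sqrt e ^+ 2)^-1 * 1) * Num.sqrt e = eps / Num.sqrt e.
    by field; rewrite gt_eqF.
  rewrite ler_pdivlMr // (le_trans _ rW) // mulrC ler_wpM2l ?(ltW r0) //.
  by rewrite lerDl.
split.
  exists B, B; split => // e he; have [-> bnd] := main e he.
  by rewrite !lee_fin; move: bnd; rewrite -/(B e) ler_norml => /andP[h h'];
    apply/andP; split; lra.
move=> sigma0 scvg.
pose L e : R := (1 - (2 * n%:R)^-1) * norm2 (sigma e) ^+ 2.
have Lcvg : L e @[e --> 0^'+] --> (1 - (2 * n%:R)^-1) * norm2 sigma0 ^+ 2.
  apply: cvgMl_tmp; rewrite norm2_sqr; under eq_fun do rewrite norm2_sqr.
  apply: cvg_sumr => i; apply: cvg_sumr => j; rewrite -expr2.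
  by under eq_fun do rewrite -expr2; exact: scvg.
have Wcvg : W * Num.sqrt e @[e --> 0^'+] --> (0 : R).
  by rewrite -[X in _ --> X](mulr0 W); exact: cvgMl_tmp.
apply/fine_cvgP; split.
  by near=> e; have [|-> _] := main e; first by near: e.
(* Multiplied by [e], the error [W / Num.sqrt e] becomes [W * Num.sqrt e], which vanishes in the
   limit. *)
apply: (@squeeze_cvgr _ _ _ _ (fun e => L e - W * Num.sqrt e) (fun e => L e + W * Num.sqrt e)).
- near=> e; have he : 0 < e <= min_entry nu / (2 * norm2 k) by near: e.
  have [E bnd] := main e he; rewrite /= E /= -/(m e).
  have /andP[e_gt0 _] := he; have r0 : 0 < Num.sqrt e by rewrite sqrtr_gt0.
  have h := ler_wpM2l (ltW e_gt0) bnd.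
  move: h; rewrite -{1}(gtr0_norm e_gt0) -normrM.
  have -> : e * (m e - (1 - (2 * n%:R)^-1) * (norm2 (sigma e) ^+ 2 / e)) = e * m e - L e.
    by rewrite /L; field; rewrite !gt_eqF.
  have -> : e * (W / Num.sqrt e) = W * Num.sqrt e.
    by rewrite -{1}(sqr_sqrtr (ltW e_gt0)); field; rewrite gt_eqF.
  by rewrite ler_norml => /andP[h h']; apply/andP; split; lra.
- rewrite -[X in _ --> X]subr0; exact: cvgB.
- rewrite -[X in _ --> X]addr0; exact: cvgD.
Unshelve. all: by end_near. Qed.
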